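(* Let $\mu = w\,dm$ be an absolutely continuous probability measure in $\mathrm{Sz}(\mathbb{T})$ such that $w$ is positive and continuous in a neighbourhood $I \subset \mathbb{T}$ of a point $\zeta \in \mathbb{T}$. Assume, moreover, that for some $s>0$ we have $|w(\xi) - w(\zeta)| \sim |\xi - \zeta|^{s}$ for all $\xi \in I$. Then $$ \mathcal{K}_{\mu}(\rho\zeta) \sim \begin{cases} 1-\rho, & s \in (1/2, +\infty),\\ (1-\rho)|\log(1-\rho)|, & s =1/2,\\ (1-\rho)^{2s}, & s \in (0, 1/2), \end{cases} $$ for $\rho \in (0, 1)$ close enough to $1$. The constants involved depend on $s$, the diameter of $I$, the value $w(\zeta)$, and the constants in the relation $|w(\xi) - w(\zeta)| \sim |\xi - \zeta|^{s}$.
   Context: $\mathbb{T}=\{z\in\mathbb{C}: |z|=1\}$, $\mathbb{D}=\{z\in\mathbb{C}: |z|<1\}$, and $m$ is Lebesgue measure on $\mathbb{T}$ normalized by $m(\mathbb{T})=1$. The Szegő class $\mathrm{Sz}(\mathbb{T})$ is the set of Borel probability measures $\mu$ on $\mathbb{T}$ such that, if $\mu = w\,dm+\mu_s$ is the decomposition into absolutely continuous and singular parts with respect to $m$, then $\int_{\mathbb{T}}\log w\,dm>-\infty$ (equivalently $\log w\in L^1(m)$). For $\mu\in \mathrm{Sz}(\mathbb{T})$ the entropy function is $$\mathcal{K}_{\mu}(z)=\log\left(\int_{\mathbb{T}}\frac{1-|z|^2}{|1-\bar\xi z|^2}\,d\mu(\xi)\right)-\int_{\mathbb{T}}\log w(\xi)\,\frac{1-|z|^2}{|1-\bar\xi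 z|^2}\,dm(\xi),\qquad z\in\mathbb{D}.$$ For nonnegative functions $f,g$ on a common set, $f\sim g$ means that there are constants $c_1,c_2>0$ with $c_1 g\le f\le c_2 g$ everywhere on that set.
   Formalization: For s > 1/2 the upper constant may also depend on the integral of log w over the circle, since w may be arbitrarily small off I and the stated dependence then fails; ''diameter of I'' is taken as the diameter of an arc centred at ζ contained in I. *)

(* Defs.v *)
From HB Require Import structures.
From mathcomp Require Import all_boot all_order all_algebra complex.
From mathcomp Require Import all_classical all_reals all_analysis.
From mathcomp Require Import measurable_realfun.

Set Implicit Arguments.
Unset Strict Implicit.
Unset Printing Implicit Defensive.

Import Order.TTheory GRing.Theory Num.Theory numFieldNormedType.Exports.
Import ComplexField.Normc.

Local Open Scope classical_set_scope.
Local Open Scope ring_scope.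

(* [R[i]] carries its canonical topology under the alias [R[i]^o]. Its numeric
   norm [`|z|] is valued in [R[i]]; [normc] is the same modulus valued in [R]. *)
Definition circle (R : realType) : Type :=
  set_type [set z : R[i]^o | normc z = 1].

HB.instance Definition _ (R : realType) := Choice.on (circle R).
HB.instance Definition _ (R : realType) := Topological.on (circle R).

Definition circle_val (R : realType) (xi : circle R) : R[i] := set_val xi.

Lemma normc_expi (R : realType) (t : R) :
  [set z : R[i]^o | normc z = 1] (Complex (cos t) (sin t)).
Proof. by rewrite /= cos2Dsin2 sqrtr1. Qed.

Definition expi (R : realType) : measurableTypeR R -> circle R := fun t : R =>
  @exist R[i] _ (Complex (cos t) (sin t)) (mem_set (normc_expi t)).

HB.instance Definition _ (R : realType) := isPointed.Build (circle R) (expi (0 : R)).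

HB.instance Definition _ (R : realType) := Measurable.copy (circle R)
  (g_sigma_algebraType (@open (circle R))).

Lemma continuous_expi (R : realType) : continuous (@expi R : R -> circle R).
Proof.
suff c : continuous (fun t : R => Complex (cos t) (sin t) : R[i]^o).
  exact: (@continuous_comp_initial (circle R) R R[i]^o set_val (@expi R) c).
move=> t.
suff: forall e : R[i], 0 < e -> \forall u \near t,
    `|(Complex (cos t) (sin t) : R[i]^o) - Complex (cos u) (sin u)| < e.
  exact: (iffRL (@cvgrPdist_lt R[i] R[i]^o _ _ _
    (fun u : R => Complex (cos u) (sin u)) _)).
move=> e; rewrite ltcE /= => /andP[/eqP ie re].
have e2 : 0 < complex.Re e / 2 by rewrite divr_gt0.
have cs : \forall u \near t, `|cos t - cos u| < complex.Re e / 2.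
  have /cvgrPdist_lt := @continuous_cos R t; exact.
have sn : \forall u \near t, `|sin t - sin u| < complex.Re e / 2.
  have /cvgrPdist_lt := @continuous_sin R t; exact.
near=> u.
rewrite normc_def ltcE /= -ie eqxx /=.
have h1 : `|cos t - cos u| < complex.Re e / 2 by near: u.
have h2 : `|sin t - sin u| < complex.Re e / 2 by near: u.
rewrite -(ltr_pXn2r (n := 2)) ?nnegrE ?sqrtr_ge0 ?(ltW re)//.
rewrite sqr_sqrtr ?addr_ge0 ?sqr_ge0//.
rewrite -(real_normK (num_real (cos t - cos u))).
rewrite -(real_normK (num_real (sin t - sin u))).
apply: (@le_lt_trans _ _ ((`|cos t - cos u| + `|sin t - sin u|) ^+ 2)).
  by rewrite sqrrD addrAC lerDl mulrn_wge0 ?mulr_ge0.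
rewrite ltr_pXn2r ?nnegrE ?addr_ge0 ?(ltW re)//.
by rewrite [ltRHS]splitr ltrD.
Unshelve. all: by end_near. Qed.

Lemma measurable_expi (R : realType) : measurable_fun [set: R] (@expi R).
Proof.
apply: (measurability (@open (circle R))) => // _ [U oU <-].
rewrite setTI; apply: open_measurable.
by apply: open_comp oU => t _; exact: continuous_expi.
Qed.

Lemma pi2_gt0 (R : realType) : 0 < 2 * pi :> R.
Proof. by rewrite mulr_gt0 ?pi_gt0. Qed.

HB.instance Definition _ (R : realType) :=
  isMeasurableFun.Build _ _ (measurableTypeR R) (circle R) (@expi R)
    (@measurable_expi R).

(* Normalized Lebesgue measure on the circle: the image of the uniform
   probability on [0, 2 pi] under t |-> e^{it}. *)
Definition circle_measure (R : realType) : probability (circle R) R :=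
  distribution (uniform_prob (pi2_gt0 R)) (@expi R).

Definition poisson_kernel (R : realType) (z : R[i]) (xi : circle R) : R :=
  (1 - normc z ^+ 2) / normc (1 - conjc (circle_val xi) * z) ^+ 2.

Section szego.
Context (R : realType).
Local Open Scope ereal_scope.

Definition lebesgue_decomposition (mu : set (circle R) -> \bar R)
    (w : circle R -> R) (mus : set (circle R) -> \bar R) : Prop :=
  [/\ measurable_fun setT w,
      forall xi, (0 <= w xi)%R,
      exists N : set (circle R),
        [/\ measurable N, circle_measure R N = 0 & mus (~` N) = 0] &
      forall A, measurable A ->
        mu A = \int[circle_measure R]_(xi in A) (w xi)%:E + mus A].

(* [lne] is used rather than [ln] because [ln 0 = 0]: here log 0 = -oo. *)
Definition log_integral (w : circle R -> R) : \bar R :=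
  \int[circle_measure R]_xi lne (w xi)%:E.

(* The decomposition exists, and [w] is unique up to m-null sets, by Lebesgue's
   theorem; so "for all decompositions" means "for the decomposition". *)
Definition szego (mu : probability (circle R) R) : Prop :=
  forall (w : circle R -> R) (mus : {measure set (circle R) -> \bar R}),
    lebesgue_decomposition mu w mus -> -oo < log_integral w.

(* [w] is the density of the absolutely continuous part of [mu]; being unique up
   to m-null sets, it does not affect the value. *)
Definition entropy (mu : set (circle R) -> \bar R) (w : circle R -> R)
    (z : R[i]) : \bar R :=
  lne (\int[mu]_xi (poisson_kernel z xi)%:E) -
  \int[circle_measure R]_xi (lne (w xi)%:E * (poisson_kernel z xi)%:E).

End szego.

Definition centered_arc (R : realType) (zeta : circle R) (r : R) : set (circle R) :=
  [set xi | normc (circle_val xi - circle_val zeta) < r].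

Definition diam (R : realType) (A : set (circle R)) : R :=
  sup [set normc (circle_val xi - circle_val eta) | xi in A & eta in A].

Definition decay_rate (R : realType) (s rho : R) : R :=
  if 1 / 2 < s then 1 - rho
  else if s == 1 / 2 then (1 - rho) * `|ln (1 - rho)|
  else (1 - rho) `^ (2 * s).

(* Main.v *)
(** Write [u] for the density and [P] for the Poisson kernel at [rho * zeta].
    Since [P] has mean 1, for every [B > 0] one has, with [A] the [P]-mean of
    [u], [entropy <= int (ln B + u/B - 1 - ln u) P dm], with equality at
    [B = A].  The integrand is nonnegative and comparable to [(u - B)^2] where
    [u] is close to [B].  Taking [B = u(zeta)] for the upper bound and [B = A]
    for the lower one reduces the theorem to estimating
    [int |xi - zeta|^(2 s) P dm], which is done by summing over dyadic annuli
    around [zeta], using only that an arc of radius [t] has measure comparable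
    to [t].  In the lower bound, [A] differs from [u(zeta)] by
    [O((1 - rho)^min(s, 1/2))], so that [|u - A|] is at least half of
    [|u - u(zeta)|] away from [zeta]: beyond distance [M (1 - rho)] when
    [s <= 1/2], beyond a fixed distance when [s > 1/2].  The arc on which [u] is
    unknown contributes [O(1 - rho)]: this is negligible when [s <= 1/2], and
    otherwise accounts for the dependence of [c2] on [int log u dm]. *)

Require Import Defs.
From HB Require Import structures.
From mathcomp Require Import all_boot all_order all_algebra complex.
From mathcomp Require Import all_classical all_reals all_analysis.
From mathcomp Require Import measurable_realfun.
From mathcomp Require Import ring lra.

Set Implicit Arguments.
Unset Strict Implicit.
Unset Printing Implicit Defensive.

Import Order.TTheory GRing.Theory Num.Theory numFieldNormedType.Exports.
Import ComplexField.Normc.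

Local Open Scope classical_set_scope.
Local Open Scope ring_scope.

(** * Cauchy kernel integrals over dyadic annuli *)

Section integral_bounds.
Context d (T : measurableType d) (R : realType) (mu : {measure set T -> \bar R}).
Variables (D : set T) (f : T -> R) (b c : R).
Hypotheses (mD : measurable D) (mf : measurable_fun D f) (c0 : 0 <= c).

Lemma integral_le_cst : (mu D <= b%:E)%E -> (forall x, D x -> 0 <= f x <= c) ->
  (\int[mu]_(x in D) (f x)%:E <= (c * b)%:E)%E.
Proof.
move=> mub fc; rewrite EFinM.
apply: (@le_trans _ _ (c%:E * mu D)%E); last by rewrite lee_wpmul2l.
rewrite -integral_cst//; apply: ge0_le_integral => //=.
- by move=> x /fc/andP[].
- exact/measurable_EFinP.
- by move=> x /fc/andP[].
Qed.

Lemma integral_ge_cst : (b%:E <= mu D)%E -> (forall x, D x -> c <= f x) ->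
  ((c * b)%:E <= \int[mu]_(x in D) (f x)%:E)%E.
Proof.
move=> mub fc; rewrite EFinM.
apply: (@le_trans _ _ (c%:E * mu D)%E); first by rewrite lee_wpmul2l.
rewrite -integral_cst//; apply: ge0_le_integral => //=.
exact/measurable_EFinP.
Qed.

End integral_bounds.

(** The least [n] with [M < b ^+ n * a] works: minimality keeps the preceding power at most [M]. It
    counts the annuli needed to reach a given radius. *)
Lemma geometric_scale (R : realType) (b a M : R) : 1 < b -> 0 < a -> a <= M ->
  exists n : nat, M < b ^+ n * a /\ b ^+ n * a <= b * M.
Proof.
move=> b1 a0 aM; have b0 : 0 < b by exact: lt_trans b1.
have M0 : 0 < M by exact: lt_le_trans aM.
have ex : exists n, M < b ^+ n * a.
  have lb : 0 < ln b by exact: ln_gt0.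
  exists (Num.bound `|ln (M / a) / ln b|).
  rewrite -ltr_pdivrMr// -ltr_ln ?posrE ?divr_gt0 ?exprn_gt0// lnXn//.
  rewrite -mulr_natl -ltr_pdivrMr//.
  apply: (le_lt_trans (ler_norm _)); exact: archi_boundP (normr_ge0 _).
case: (ex_minnP ex) => n Mn nmin; exists n; split => //.
case: n Mn nmin => [|n] Mn nmin.
  by move: Mn; rewrite expr0 mul1r ltNge aM.
rewrite exprS -mulrA ler_pM2l// leNgt; apply/negP => /nmin.
by rewrite ltnn.
Qed.

Section dist_balls.
Context d (T : measurableType d) (R : realType).
Variable dist : T -> R.

Definition dball (t : R) : set T := [set x | dist x < t].

Definition annulus (a b : R) : set T := [set x | a <= dist x < b].

(** With [e = 1 - rho], a simpler substitute for the Poisson kernel, comparable to it as soon as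
    [rho >= 1 / 2]. *)
Definition cauchy_kernel (e : R) (x : T) : R := e / (e ^+ 2 + dist x ^+ 2).

(** Apart from the mean of the Poisson kernel being 1, this is all that the estimates use of the
    circle. The constants are crude: there, the ball of radius [t <= 2] has measure
    [(2 / pi) arcsin (t / 2)]. *)
Definition ball_regular (m : probability T R) : Prop :=
  [/\ measurable_fun setT dist, forall x, 0 <= dist x <= 2,
      forall t, 0 < t -> (m (dball t) <= (3 * t)%:E)%E &
      forall t, 0 < t -> t <= 2 -> ((t / 8)%:E <= m (dball t))%E].

End dist_balls.

(** For [0 < e <= t], the denominator [e ^+ 2 + dist x ^+ 2] is at most this constant times [t ^+ 2]
    on [annulus t (32 * t)]. *)
Definition annulus_cst (R : realType) : R := (1 + 1) * 32 ^+ 2.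

Section regular.
Context d (T : measurableType d) (R : realType).
Variables (m : probability T R) (dist : T -> R).
Hypothesis reg : ball_regular dist m.

Local Notation ball := (dball dist).
Local Notation annulus := (annulus dist).
Local Notation cauchy_kernel := (cauchy_kernel dist).

Let mdist : measurable_fun setT dist.
Proof. by case: reg. Qed.

Let dist_ge0 x : 0 <= dist x.
Proof. by case: reg => _ /(_ x)/andP[]. Qed.

Let dist_le2 x : dist x <= 2.
Proof. by case: reg => _ /(_ x)/andP[]. Qed.

Let ball_le t : 0 < t -> (m (ball t) <= (3 * t)%:E)%E.
Proof. by case: reg => _ _ h _; exact: h. Qed.

Let ball_ge t : 0 < t -> t <= 2 -> ((t / 8)%:E <= m (ball t))%E.
Proof. by case: reg => _ _ _ h; exact: h. Qed.

Lemma measurable_ball t : measurable (ball t).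
Proof.
have := mdist measurableT (measurable_itv `]-oo, t[).
by rewrite setTI; congr measurable; apply/seteqP; split => x /=; rewrite in_itv.
Qed.

Lemma measurable_annulus a b : measurable (annulus a b).
Proof.
rewrite (_ : annulus a b = ball b `&` ~` ball a); last first.
  apply/seteqP; split => x; rewrite /dball/annulus/=.
    by move=> /andP[ax ->]; split=> //; rewrite ltNge ax.
  by case=> -> /negP; rewrite -leNgt => ->.
by apply: measurableI; [|apply: measurableC]; exact: measurable_ball.
Qed.

(* The ratio 32 is such that [32 t / 8 - 3 t = t]. *)
Lemma annulus_ge t : 0 < t -> 32 * t <= 2 -> (t%:E <= m (annulus t (32 * t)))%E.
Proof.
move=> t0 t2.
have : (m (ball (32 * t)) <= m (ball t) + m (annulus t (32 * t)))%E.
  rewrite (_ : ball (32 * t) = ball t `|` annulus t (32 * t)).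
    by apply: measureU2; do ?[exact: measurable_ball|exact: measurable_annulus].
  apply/seteqP; split => x; rewrite /dball/annulus/=.
    by move=> ->; rewrite andbT; case: ltP; [left|right].
  by case=> [xt|/andP[]//]; rewrite (lt_trans xt)// ltr_pMl// ltr1n.
have h1 := ball_ge (mulr_gt0 (ltr0n R 32) t0) t2.
have h2 := ball_le t0.
have fin A : measurable A -> m A = (fine (m A))%:E.
  by move=> mA; rewrite fineK// fin_num_measure.
move: h1 h2; rewrite (fin _ (measurable_ball (32 * t))) (fin _ (measurable_ball t))
  (fin _ (measurable_annulus _ _)).
rewrite -EFinD !lee_fin; lra.
Qed.

Lemma measurable_kernel e : measurable_fun setT (cauchy_kernel e).
Proof.
rewrite (_ : cauchy_kernel e = fun x => e * (e ^+ 2 + dist x ^+ 2) `^ (-1)).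
  apply: measurable_funM => //.
  apply: (measurableT_comp (measurable_powR _)).
  by apply: measurable_funD => //; exact: measurable_funX.
by apply/funext => x; rewrite powR_inv1// addr_ge0 ?sqr_ge0.
Qed.

Lemma measurable_dist_kernel p e :
  measurable_fun setT (fun x => dist x `^ p * cauchy_kernel e x).
Proof.
apply: measurable_funM; last exact: measurable_kernel.
exact: (measurableT_comp (measurable_powR _)).
Qed.

Lemma cauchy_kernel_ge0 e x : 0 <= e -> 0 <= cauchy_kernel e x.
Proof. by move=> e0; rewrite divr_ge0// addr_ge0 ?sqr_ge0. Qed.

(** The annulus between the radii [2^k e] and [2^(k+1) e] has measure [O(2^k e)], and the kernel
    there is at most [e / (2^k e)^2]; so it contributes a multiple of [e^p (2^p / 2)^k]. The
    innermost ball, where the kernel is at most [1 / e], accounts for the summand 1. *)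
Lemma dyadic_ub p e n : 0 < p -> 0 < e ->
  (\int[m]_(x in ball (2 ^+ n * e)) (dist x `^ p * cauchy_kernel e x)%:E
   <= (6 * 2 `^ p * e `^ p * (1 + \sum_(k < n) (2 `^ p / 2) ^+ k))%:E)%E.
Proof.
move=> p0 e0; have pn0 k : 0 < 2 ^+ k * e by rewrite mulr_gt0// exprn_gt0.
have g0 x : 0 <= dist x `^ p * cauchy_kernel e x.
  by rewrite mulr_ge0 ?powR_ge0// cauchy_kernel_ge0 ?ltW.
have mg D : measurable_fun D (fun x => dist x `^ p * cauchy_kernel e x).
  exact/measurable_funTS/measurable_dist_kernel.
have p2 : 1 <= 2 `^ p by rewrite -[leLHS](powRr0 2) ler_powR ?ler1n// ltW.
have powE k : (2 ^+ k * e) `^ p = (2 `^ p) ^+ k * e `^ p.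
  rewrite powRM; [|by rewrite exprn_ge0|exact: ltW].
  by rewrite -(powR_mulrn k (ler0n R 2)) powRAC powR_mulrn ?powR_ge0.
elim: n => [|n ih].
  rewrite big_ord0 addr0 mulr1 expr0 mul1r.
  apply: (@le_trans _ _ ((e `^ p / e) * (3 * e))%:E).
    apply: integral_le_cst (ball_le e0) _ => //; first exact: measurable_ball.
      by rewrite divr_ge0 ?powR_ge0// ltW.
    move=> x; rewrite /dball/= => xe; rewrite g0/=; apply: ler_pM.
    + exact: powR_ge0.
    + by rewrite cauchy_kernel_ge0// ltW.
    + by apply: ge0_ler_powR; rewrite ?nnegrE//; exact: ltW.
    + rewrite /cauchy_kernel ler_pdivrMr ?ltr_pwDl ?exprn_gt0 ?sqr_ge0//.
      by rewrite mulrDr expr2 mulKf ?gt_eqF// lerDl mulr_ge0 ?sqr_ge0// invr_ge0 ltW.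
  rewrite lee_fin (_ : e `^ p / e * (3 * e) = 3 * e `^ p).
    by rewrite ler_wpM2r ?powR_ge0//; lra.
  by field; rewrite gt_eqF.
rewrite big_ord_recr/= addrA mulrDr EFinD.
set A := annulus (2 ^+ n * e) (2 ^+ n.+1 * e).
rewrite (_ : ball (2 ^+ n.+1 * e) = ball (2 ^+ n * e) `|` A); last first.
  apply/seteqP; split => x; rewrite /dball/A/annulus/=.
    by move=> ->; rewrite andbT; case: ltP; [left|right].
  case=> [xt|/andP[]//]; rewrite (lt_trans xt)// ltr_pM2r//.
  by rewrite exprS ltr_pMl ?exprn_gt0// ltr1n.
rewrite ge0_integral_setU//=; last 5 first.
- exact: measurable_ball.
- exact: measurable_annulus.
- exact/measurable_EFinP.
- by move=> x _; rewrite lee_fin.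
- apply/disj_setPS => x; rewrite /dball/A/annulus/= => -[xl /andP[xg _]].
  by move: xl; rewrite ltNge xg.
apply: leeD => //.
set t := 2 ^+ n * e in A *.
have t0 : 0 < t by exact: pn0.
have tE : 2 ^+ n.+1 * e = 2 * t by rewrite exprS mulrA.
have mA : (m A <= (3 * (2 * t))%:E)%E.
  apply: le_trans (ball_le (mulr_gt0 (ltr0n R 2) t0)).
  apply: le_measure; rewrite ?inE; [exact: measurable_annulus|exact: measurable_ball|].
  by move=> x; rewrite /A/annulus/dball/= tE => /andP[].
apply: (@le_trans _ _ ((2 * t) `^ p * (e / t ^+ 2) * (3 * (2 * t)))%:E).
  apply: integral_le_cst mA _ => //; first exact: measurable_annulus.
    by rewrite mulr_ge0 ?powR_ge0// divr_ge0 ?sqr_ge0// ltW.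
  move=> x; rewrite /A/annulus/= tE => /andP[tx xt]; rewrite g0/=; apply: ler_pM.
  + exact: powR_ge0.
  + by rewrite cauchy_kernel_ge0// ltW.
  + by apply: ge0_ler_powR; rewrite ?nnegrE//; [exact: ltW|rewrite mulr_ge0// ltW|exact: ltW].
  + rewrite /cauchy_kernel ler_pM2l// lef_pV2 ?posrE ?exprn_gt0//.
      by rewrite (@le_trans _ _ (dist x ^+ 2)) ?lerDr ?sqr_ge0// lerXn2r ?nnegrE// ltW.
    by rewrite ltr_pwDl ?exprn_gt0 ?sqr_ge0.
rewrite lee_fin powRM//; last exact: ltW.
rewrite powE expr_div_n /t.
rewrite le_eqVlt; apply/orP; left; apply/eqP.
by field; rewrite gt_eqF ?exprn_gt0//= gt_eqF.
Qed.

Lemma dyadic_ub_total p e n : 0 < p -> 0 < e -> 2 < 2 ^+ n * e ->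
  (\int[m]_x (dist x `^ p * cauchy_kernel e x)%:E
   <= (6 * 2 `^ p * e `^ p * (1 + \sum_(k < n) (2 `^ p / 2) ^+ k))%:E)%E.
Proof.
move=> p0 e0 n1; have -> : setT = ball (2 ^+ n * e).
  by apply/esym/seteqP; split => // x _; rewrite /dball/=; exact: le_lt_trans n1.
exact: dyadic_ub.
Qed.

Local Notation K0 := (annulus_cst R).

Let K0_gt0 : 0 < K0.
Proof. by rewrite mulr_gt0 ?exprn_gt0. Qed.

Lemma annulus_integral_ge s e t : 0 < s -> 0 < e -> e <= t -> 32 * t <= 2 ->
  ((t `^ (2 * s) * (e / (K0 * t ^+ 2)) * t)%:E
   <= \int[m]_(x in annulus t (32 * t)) (dist x `^ (2 * s) * cauchy_kernel e x)%:E)%E.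
Proof.
move=> s0 e0 et t2; have t0 : 0 < t by exact: lt_le_trans et.
have k0 : 0 < K0 * t ^+ 2 by rewrite mulr_gt0// exprn_gt0.
apply: integral_ge_cst (annulus_ge t0 t2) _.
- exact: measurable_annulus.
- exact/measurable_funTS/measurable_dist_kernel.
- by rewrite mulr_ge0 ?powR_ge0// divr_ge0// ltW.
move=> x; rewrite /annulus/= => /andP[tx xt]; apply: ler_pM.
- exact: powR_ge0.
- by rewrite divr_ge0// ltW.
- by apply: ge0_ler_powR; rewrite ?nnegrE//; [rewrite mulr_ge0// ltW|exact: ltW].
rewrite /cauchy_kernel ler_pM2l// lef_pV2 ?posrE//; last first.
  by rewrite ltr_pwDl ?exprn_gt0 ?sqr_ge0.
rewrite /annulus_cst -mulrA -exprMn mulrDl mul1r.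
apply: lerD; rewrite lerXn2r ?nnegrE ?mulr_ge0 ?(ltW t0) ?(ltW e0) ?(ltW xt)//.
by rewrite (le_trans et)// ler_peMl ?ler1n// ltW.
Qed.

(** At [s = 1/2] the lower bound for one annulus, [t * (e / (K0 t^2)) * t = e / K0], does not depend
    on its radius. So [n] consecutive annuli give [n] times as much: this is the source of the
    logarithm. *)
Lemma log_annulus_ge e a n : 0 < e -> e <= a -> 32 ^+ n * a <= 2 ->
  ((n%:R * (e / K0))%:E
   <= \int[m]_(x in annulus a (32 ^+ n * a))
        (dist x `^ (2 * (1 / 2)) * cauchy_kernel e x)%:E)%E.
Proof.
move=> e0 ea; have a0 : 0 < a by exact: lt_le_trans ea.
have g0 x : 0 <= dist x `^ (2 * (1 / 2)) * cauchy_kernel e x.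
  by rewrite mulr_ge0 ?powR_ge0// cauchy_kernel_ge0 ?ltW.
elim: n => [|n ih] h.
  by rewrite mul0r integral_ge0// => x _; rewrite lee_fin.
have h1 : 32 * (32 ^+ n * a) <= 2 by rewrite mulrA -exprS.
have an : a <= 32 ^+ n * a by rewrite ler_peMl ?exprn_ege1 ?ler1n// ltW.
have h0 : 32 ^+ n * a <= 2.
  by apply: le_trans h1; rewrite ler_peMl ?ler1n// mulr_ge0 ?exprn_ge0// ltW.
rewrite (_ : annulus a (32 ^+ n.+1 * a) =
    annulus a (32 ^+ n * a) `|` annulus (32 ^+ n * a) (32 * (32 ^+ n * a))); last first.
  rewrite exprS -mulrA; apply/seteqP; split => x; rewrite /annulus/=.
    by move=> /andP[-> ->]; rewrite andbT/=; case: ltP; [left|right].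
  case=> /andP[ax xb]; rewrite ?ax ?xb/= ?andbT.
    by rewrite (lt_le_trans xb)// ler_peMl ?ler1n// mulr_ge0 ?exprn_ge0// ltW.
  exact: le_trans ax.
rewrite ge0_integral_setU//=; last 5 first.
- exact: measurable_annulus.
- exact: measurable_annulus.
- exact/measurable_EFinP/measurable_funTS/measurable_dist_kernel.
- by move=> x _; rewrite lee_fin.
- apply/disj_setPS => x; rewrite /annulus/= => -[/andP[_ xl] /andP[xg _]].
  by move: xl; rewrite ltNge xg.
rewrite -natr1 mulrDl mul1r EFinD; apply: leeD; first exact: ih.
have ean : e <= 32 ^+ n * a by exact: le_trans an.
apply: le_trans (annulus_integral_ge _ e0 ean h1); rewrite ?divr_gt0//.
have t0 : 0 < 32 ^+ n * a by rewrite mulr_gt0 ?exprn_gt0.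
rewrite lee_fin (_ : 2 * (1 / 2) = 1); last by rewrite mulrCA divff ?mulr1.
rewrite powRr1 ?(ltW t0)//.
rewrite le_eqVlt; apply/orP; left; apply/eqP.
by field; rewrite !gt_eqF ?exprn_gt0.
Qed.

End regular.

(** * Kernel integrals in the three regimes of the exponent *)

Section kernel_integrals.
Context d (T : measurableType d) (R : realType).
Implicit Types (m : probability T R) (dist : T -> R) (s e M r : R).

(** The three regimes are those of a geometric sum of ratio [q = 2^(2 s) / 2]: for [q > 1] its last
    term dominates, for [q = 1] it counts the annuli, and for [q < 1] it is bounded. *)
Lemma kernel_integral_le s : 0 < s -> exists C, 0 < C /\
  forall m dist e, ball_regular dist m -> 0 < e -> e <= 1 / 2 ->
  (\int[m]_x (dist x `^ (2 * s) * cauchy_kernel dist e x)%:E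
   <= (C * decay_rate s (1 - e))%:E)%E.
Proof.
move=> s0; set p := 2 * s; have p0 : 0 < p by rewrite mulr_gt0.
set q := 2 `^ p / 2; set C0 := 6 * 2 `^ p.
have C00 : 0 < C0 by rewrite mulr_gt0 ?powR_gt0.
have q0 : 0 < q by rewrite divr_gt0 ?powR_gt0.
(* The outermost radius [2 ^+ n * e] must exceed 2 for the balls to exhaust the space; it is kept at
   most 4 so that [2 ^+ n] stays comparable to [1 / e]. *)
suff [C [C1 CP]] : exists C, 0 < C /\ forall (e : R) n, 0 < e -> e <= 1 / 2 ->
    2 < 2 ^+ n * e -> 2 ^+ n * e <= 2 * 2 ->
    e `^ p * (1 + \sum_(k < n) q ^+ k) <= C * decay_rate s (1 - e).
  exists (C0 * C); split; first exact: mulr_gt0.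
  move=> m dist e reg e0 e2; have [n [n1 n2]] : exists n : nat, 2 < 2 ^+ n * e /\ 2 ^+ n * e <= 2 * 2.
    by apply: geometric_scale => //; lra.
  apply: (le_trans (dyadic_ub_total reg p0 e0 n1)); rewrite lee_fin.
  by rewrite -[leLHS]mulrA -[leRHS]mulrA ler_pM2l//; exact: CP.
have [s2|s2] := ltP (1 / 2) s.
- have q1 : 1 < q.
    rewrite /q ltr_pdivlMr// mul1r -[ltLHS](powRr1 (ler0n R 2)).
    rewrite /powR pnatr_eq0/= ltr_expR ltr_pM2r ?ln_gt0 ?ltr1n//.
    by rewrite /p; lra.
  have q10 : 0 < q - 1 by rewrite subr_gt0.
  exists (1 + 4 `^ p / (q - 1)); split.
    by rewrite addr_gt0// divr_gt0 ?powR_gt0.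
  move=> e n e0 e2 n1 n2; rewrite /decay_rate s2 opprB addrCA subrr addr0 mulrDr mulr1 mulrDl mul1r.
  apply: lerD.
    rewrite -[leRHS](powRr1 (ltW e0)); apply: ger_powR; first by rewrite e0/=; lra.
    by rewrite /p; lra.
  have -> : \sum_(k < n) q ^+ k = (q ^+ n - 1) / (q - 1).
    by rewrite subrX1 mulrAC mulfV ?gt_eqF// mul1r.
  rewrite mulrA [leRHS]mulrAC ler_pM2r ?invr_gt0//.
  apply: (@le_trans _ _ (e `^ p * q ^+ n)); first by rewrite ler_pM2l ?powR_gt0// gerBl.
  (* In this form the bounds on [2 ^+ n * e] apply: the numerator is at most [4^p], and [1 / 2 ^+ n]
     is less than [e]. *)
  have -> : e `^ p * q ^+ n = (2 ^+ n * e) `^ p / 2 ^+ n.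
    rewrite powRM; [|by rewrite exprn_ge0|exact: ltW].
    rewrite -(powR_mulrn n (ler0n R 2)) powRAC [in RHS]powR_mulrn ?powR_ge0//.
    by rewrite [in RHS]powR_mulrn// /q expr_div_n; ring.
  rewrite ler_pdivrMr ?exprn_gt0//.
  apply: (@le_trans _ _ (4 `^ p * 1)).
    rewrite mulr1; apply: ge0_ler_powR; rewrite ?nnegrE.
    + exact: ltW.
    + by rewrite mulr_ge0 ?exprn_ge0// ltW.
    + by [].
    + by lra.
  by rewrite -mulrA ler_pM2l ?powR_gt0//; lra.
- have [sE|sN] := eqVneq s (1 / 2).
    have pE : p = 1 by rewrite /p sE mulrCA divff ?mulr1.
    have qE : q = 1 by rewrite /q pE powRr1// divff.
    have l2 : 0 < ln 2 :> R by rewrite ln_gt0// ltr1n.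
    exists (4 / ln 2); split; first by rewrite divr_gt0.
    move=> e n e0 e2 n1 n2; rewrite /decay_rate sE ltxx eqxx opprB addrCA subrr addr0.
    rewrite pE powRr1 ?(ltW e0)// [leRHS]mulrCA ler_pM2l//.
    have -> : \sum_(k < n) q ^+ k = n%:R.
      under eq_bigr do rewrite qE expr1n.
      by rewrite sumr_const card_ord.
    (* The bound [2 ^+ n * e <= 4] gives [(1 + n) ln 2 <= 3 ln 2 + |ln e|], and [ln 2 <= |ln e|]
       turns the right side into [4 |ln e|]. *)
    have le0 : ln e <= - ln 2.
      by rewrite -lnV ?posrE// ler_ln ?posrE ?invr_gt0//; lra.
    rewrite ltr0_norm; last by lra.
    rewrite mulrAC ler_pdivlMr//.
    have : ln (2 ^+ n * e) <= ln (2 * 2) by rewrite ler_ln ?posrE ?mulr_gt0 ?exprn_gt0.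
    rewrite !lnM ?posrE ?exprn_gt0// lnXn// -(mulr_natl (ln 2) n) => h.
    lra.
have {sN}{}s2 : s < 1 / 2 by rewrite lt_neqAle sN.
have q1 : q < 1.
  rewrite /q ltr_pdivrMr// mul1r -[ltRHS](powRr1 (ler0n R 2)).
  rewrite /powR pnatr_eq0/= ltr_expR ltr_pM2r ?ln_gt0 ?ltr1n//.
  by rewrite /p; lra.
have q10 : 0 < 1 - q by rewrite subr_gt0.
exists (1 + 1 / (1 - q)); split; first by rewrite addr_gt0// divr_gt0.
move=> e n e0 e2 n1 n2; rewrite /decay_rate ltNge (ltW s2) (lt_eqF s2) opprB addrCA subrr addr0 mulrC ler_pM2r ?powR_gt0//.
rewrite lerD2l ler_pdivlMr// mulrC.
have -> : (1 - q) * \sum_(k < n) q ^+ k = 1 - q ^+ n.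
  by rewrite -[RHS]opprB subrX1; ring.
by rewrite gerBl exprn_ge0// ltW.
Qed.

Local Notation K0 := (annulus_cst R).

Let K0_gt0 : 0 < K0.
Proof. by rewrite mulr_gt0 ?exprn_gt0. Qed.

(** The ball of radius [M * e] is left out because the density may be too close to its mean there.
    For [s < 1/2] the first annulus beyond it already gives the full rate; for [s = 1/2] all annuli
    up to [r1] are needed. *)
Lemma kernel_integral_ge_small s M (r1 : R) : 0 < s -> s <= 1 / 2 -> 1 <= M ->
  0 < r1 -> r1 <= 1 ->
  exists c e0, [/\ 0 < c, 0 < e0 &
  forall m dist e, ball_regular dist m -> 0 < e -> e < e0 ->
  ((c * decay_rate s (1 - e))%:E
   <= \int[m]_(x in annulus dist (M * e) r1) (dist x `^ (2 * s) * cauchy_kernel dist e x)%:E)%E].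
Proof.
move=> s0 s2 M1 r0 r1_le1; have M0 : 0 < M by exact: lt_le_trans M1.
have [sE|sN] := eqVneq s (1 / 2); last first.
  have {sN}{}s2 : s < 1 / 2 by rewrite lt_neqAle sN.
  exists (M `^ (2 * s) / (K0 * M)), (r1 / 32 / M).
  split; first by rewrite divr_gt0 ?powR_gt0// mulr_gt0.
    by rewrite !divr_gt0.
  move=> m dist e reg e0; rewrite ltr_pdivlMr// ltr_pdivlMr// => eM.
  have t1 : 32 * (M * e) < r1 by rewrite mulrC (mulrC M).
  have eMe : e <= M * e by rewrite ler_peMl// ltW.
  apply: (@le_trans _ _ (\int[m]_(x in annulus dist (M * e) (32 * (M * e)))
      (dist x `^ (2 * s) * cauchy_kernel dist e x)%:E)%E); last first.
    apply: ge0_subset_integral.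
    - exact: (measurable_annulus reg).
    - exact: (measurable_annulus reg).
    - exact/measurable_EFinP/measurable_funTS/(measurable_dist_kernel reg).
    - by move=> x _; rewrite lee_fin mulr_ge0 ?powR_ge0// cauchy_kernel_ge0 ?ltW.
    - by move=> x; rewrite /annulus/= => /andP[-> /lt_trans]; exact.
  apply: le_trans (annulus_integral_ge reg s0 e0 eMe _); last by lra.
  rewrite lee_fin /decay_rate ltNge (ltW s2) (lt_eqF s2)/= opprB addrCA subrr addr0.
  rewrite powRM ?(ltW M0) ?(ltW e0)// le_eqVlt; apply/orP; left; apply/eqP.
  by field; rewrite !gt_eqF.
subst s; have l32 : 0 < ln 32 :> R by rewrite ln_gt0// ltr1n.
(* The annuli between [M * e] and [r1] number at least [(|ln e| - K) / ln 32]. Requiring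
   [e < expR (- (2 * K))] leaves at least half of [|ln e|]. *)
pose K := ln M - ln (r1 / 32).
exists (1 / (2 * K0 * ln 32)), (Num.min (1 / 2) (Num.min (r1 / 32 / M) (expR (- (2 * K))))).
split; first by rewrite divr_gt0// mulr_gt0// mulr_gt0.
  by rewrite !lt_min !divr_gt0//= expR_gt0.
move=> m dist e reg e0; rewrite !lt_min => /and3P[e2 eM eK].
have {}eM : M * e < r1 / 32 by rewrite mulrC -ltr_pdivlMr.
have eMe : e <= M * e by rewrite ler_peMl// ltW.
have Me0 : 0 < M * e by rewrite mulr_gt0.
(* The upper bound keeps the [n] annuli within radius [r1]; the lower bound makes [n] at least of
   order [|ln e|]. *)
have [n [n1 n2]] : exists n : nat, r1 / 32 < 32 ^+ n * (M * e) /\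
    32 ^+ n * (M * e) <= 32 * (r1 / 32).
  by apply: geometric_scale; rewrite ?ltr1n//; lra.
apply: (@le_trans _ _ (\int[m]_(x in annulus dist (M * e) (32 ^+ n * (M * e)))
      (dist x `^ (2 * (1 / 2)) * cauchy_kernel dist e x)%:E)%E); last first.
  apply: ge0_subset_integral.
  - exact: (measurable_annulus reg).
  - exact: (measurable_annulus reg).
  - exact/measurable_EFinP/measurable_funTS/(measurable_dist_kernel reg).
  - by move=> x _; rewrite lee_fin mulr_ge0 ?powR_ge0// cauchy_kernel_ge0 ?ltW.
  - move=> x; rewrite /annulus/= => /andP[-> /lt_le_trans]; apply; lra.
apply: (@le_trans _ _ (n%:R * (e / K0))%:E); last first.
  by apply: (log_annulus_ge reg) => //; lra.
rewrite lee_fin /decay_rate ltxx eqxx opprB addrCA subrr addr0.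
have lK : ln e < - (2 * K) by rewrite -(expRK (- (2 * K))) ltr_ln ?posrE ?expR_gt0.
have le0 : ln e < 0 by rewrite ln_lt0// e0/=; lra.
rewrite ltr0_norm//.
have nl : - ln e / 2 < n%:R * ln 32.
  have : ln (r1 / 32) < ln (32 ^+ n * (M * e)).
    by rewrite ltr_ln ?posrE ?divr_gt0// mulr_gt0// exprn_gt0.
  have -> : ln (32 ^+ n * (M * e)) = n%:R * ln 32 + (ln M + ln e).
    by rewrite lnM ?posrE ?exprn_gt0// lnM ?posrE// lnXn// mulr_natl.
  by move: lK; rewrite /K; lra.
have -> : n%:R * (e / K0) = e * (n%:R * ln 32) / (K0 * ln 32) by field; rewrite !gt_eqF.
have -> : 1 / (2 * K0 * ln 32) * (e * - ln e) = e * (- ln e / 2) / (K0 * ln 32).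
  by field; rewrite !gt_eqF.
by rewrite ler_pM2r ?invr_gt0 ?mulr_gt0// ler_pM2l// ltW.
Qed.

(** For [s > 1/2] points at a fixed distance already give the full rate, since the kernel is of
    order [e] there. *)
Lemma kernel_integral_ge_large s (r1 : R) : 0 < s -> 1 / 2 < s -> 0 < r1 -> r1 <= 1 ->
  exists c e0, [/\ 0 < c, 0 < e0 &
  forall m dist e, ball_regular dist m -> 0 < e -> e < e0 ->
  ((c * decay_rate s (1 - e))%:E
   <= \int[m]_(x in annulus dist (r1 / 32) r1) (dist x `^ (2 * s) * cauchy_kernel dist e x)%:E)%E].
Proof.
move=> s0 s2 r0 r1_le1; set t := r1 / 32; have t0 : 0 < t by rewrite divr_gt0.
exists (t `^ (2 * s) / (K0 * t)), t; split => //.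
  by rewrite divr_gt0 ?powR_gt0// mulr_gt0.
move=> m dist e reg e0 et; rewrite (_ : r1 = 32 * t); last by rewrite mulrC divfK.
apply: le_trans (annulus_integral_ge reg s0 e0 (ltW et) _); last by rewrite /t; lra.
rewrite lee_fin /decay_rate s2 opprB addrCA subrr addr0.
rewrite le_eqVlt; apply/orP; left; apply/eqP.
by field; rewrite !gt_eqF.
Qed.

End kernel_integrals.

(** * The unit circle *)

Section circle.
Context (R : realType).
Implicit Types (t x : R) (xi zeta : circle R).

Definition circle_dist zeta xi : R := normc (circle_val xi - circle_val zeta).

Lemma normc_sqr (a b : R) : normc (Complex a b) ^+ 2 = a ^+ 2 + b ^+ 2.
Proof. by rewrite /normc sqr_sqrtr// addr_ge0 ?sqr_ge0. Qed.

Lemma normc_ge0 (z : R[i]) : 0 <= normc z.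
Proof. by case: z => a b; exact: sqrtr_ge0. Qed.

Lemma circle_sqr xi :
  complex.Re (circle_val xi) ^+ 2 + complex.Im (circle_val xi) ^+ 2 = 1.
Proof.
have : normc (circle_val xi) = 1 by exact: (set_valP xi).
by case: (circle_val xi) => a b h; rewrite -normc_sqr h expr1n.
Qed.

Lemma circle_dist_ge0 zeta xi : 0 <= circle_dist zeta xi.
Proof. exact: normc_ge0. Qed.

Lemma circle_dist_sqr zeta xi : circle_dist zeta xi ^+ 2 =
  2 - 2 * (complex.Re (circle_val xi) * complex.Re (circle_val zeta)
           + complex.Im (circle_val xi) * complex.Im (circle_val zeta)).
Proof.
rewrite /circle_dist; have := circle_sqr xi; have := circle_sqr zeta.
case: (circle_val xi) => a b; case: (circle_val zeta) => a0 b0 h h'.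
rewrite /= in h h'; rewrite (_ : Complex a b - _ = Complex (a - a0) (b - b0))// normc_sqr.
have -> : (a - a0) ^+ 2 + (b - b0) ^+ 2 =
  (a0 ^+ 2 + b0 ^+ 2) + (a ^+ 2 + b ^+ 2) - 2 * (a * a0 + b * b0) by ring.
by rewrite h h'.
Qed.

Lemma circle_dist_le2 zeta xi : circle_dist zeta xi <= 2.
Proof.
rewrite -(@ler_pXn2r _ 2) ?nnegrE ?circle_dist_ge0// circle_dist_sqr.
have := circle_sqr xi; have := circle_sqr zeta.
move: (complex.Re (circle_val xi)) (complex.Im (circle_val xi)) => a b.
move: (complex.Re (circle_val zeta)) (complex.Im (circle_val zeta)) => a0 b0 h h'.
have := sqr_ge0 (a + a0); have := sqr_ge0 (b + b0).
rewrite !sqrrD => h1 h2; lra.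
Qed.

Lemma circle_dist_expi t x : circle_dist (expi x) (expi t) ^+ 2 = 2 - 2 * cos (t - x).
Proof. by rewrite circle_dist_sqr cosB. Qed.

(** On the circle [|1 - conj(xi) rho zeta|^2 = (1 - rho)^2 + rho |xi - zeta|^2], so the kernel
    depends on [xi] only through its distance to [zeta]. *)
Lemma poisson_kernelE (rho : R) zeta xi :
  poisson_kernel (real_complex R rho * circle_val zeta) xi =
  (1 - rho ^+ 2) / ((1 - rho) ^+ 2 + rho * circle_dist zeta xi ^+ 2).
Proof.
rewrite /poisson_kernel circle_dist_sqr.
have := circle_sqr xi; have := circle_sqr zeta.
case: (circle_val xi) => a b; case: (circle_val zeta) => a0 b0 h h'.
rewrite /= in h h'; have -> : real_complex R rho * Complex a0 b0 = Complex (rho * a0) (rho * b0).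
  by apply/eqP; rewrite eq_complex/= !mul0r subr0 addr0 !eqxx.
have -> : 1 - conjc (Complex a b) * Complex (rho * a0) (rho * b0) =
    Complex (1 - rho * (a * a0 + b * b0)) (- (rho * (a * b0 - b * a0))).
  by apply/eqP; rewrite eq_complex/=; apply/andP; split; apply/eqP; ring.
rewrite !normc_sqr; congr (_ / _).
  have -> : (rho * a0) ^+ 2 + (rho * b0) ^+ 2 = rho ^+ 2 * (a0 ^+ 2 + b0 ^+ 2) by ring.
  by rewrite h mulr1.
have -> : (1 - rho * (a * a0 + b * b0)) ^+ 2 + (- (rho * (a * b0 - b * a0))) ^+ 2 =
  1 - 2 * rho * (a * a0 + b * b0) + rho ^+ 2 * ((a0 ^+ 2 + b0 ^+ 2) * (a ^+ 2 + b ^+ 2)).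
  by ring.
by rewrite h h' /=; ring.
Qed.

Lemma circle_expi zeta : exists x, [/\ 0 <= x, x <= 2 * pi & zeta = expi x].
Proof.
have := circle_sqr zeta; set a := complex.Re _; set b := complex.Im _ => ab.
have zE : circle_val zeta = Complex a b by rewrite /a /b; case: (circle_val zeta).
have a1 : -1 <= a <= 1.
  by rewrite -ler_norml -(@ler_pXn2r _ 2) ?nnegrE// expr1n real_normK ?num_real// -ab lerDl sqr_ge0.
have sE : sin (acos a) = `|b|.
  rewrite sin_acos// -sqrtr_sqr; congr Num.sqrt.
  by rewrite -ab addrAC subrr add0r.
have cE : cos (acos a) = a by rewrite acosK ?in_itv.
have [b0|b0] := leP 0 b.
  exists (acos a); split; first exact: acos_ge0.
    by apply: (le_trans (acos_lepi a1)); rewrite ler_peMl ?pi_ge0// ler1n.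
  by apply/val_inj; rewrite /= cE sE ger0_norm//; exact: zE.
(* In the lower half-plane the angle given by [acos] is reflected, which keeps it in [[0, 2 pi]]. *)
exists (2 * pi - acos a); split.
- rewrite subr_ge0; apply: (le_trans (acos_lepi a1)).
  by rewrite ler_peMl ?pi_ge0// ler1n.
- by rewrite gerBl acos_ge0.
apply/val_inj; rewrite /= -(cosN (_ - _)) -(opprK (sin _)) -sinN opprB.
rewrite mulr_natl -(cosD2pi (_ - _)) -(sinD2pi (_ - _)) subrK cE sE ltr0_norm// opprK.
exact: zE.
Qed.

Lemma continuous_circle_dist zeta : continuous (circle_dist zeta).
Proof.
have cv : continuous (fun z : R[i]^o => normc (z - circle_val zeta)).
  move=> z; apply: (iffRL (@cvgrPdist_lt R R^o _ (nbhs (z : R[i]^o)) _ _ _)) => e e0.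
  have e0' : (0 : R[i]) < real_complex R e by rewrite ltcR.
  have : \forall u \near z, `|z - u| < real_complex R e.
    by exists (real_complex R e).
  apply: filterS => u; rewrite (_ : `|z - u| = real_complex R (normc (z - u)))//.
  rewrite ltcR; apply: le_lt_trans.
  set v := circle_val zeta; rewrite ler_norml.
  have h1 : normc (z - v) <= normc (z - u) + normc (u - v).
    by apply: le_trans (le_normcD _ _); rewrite addrA subrK.
  have h2 : normc (u - v) <= normc (z - u) + normc (z - v).
    rewrite -(normcN (z - u)) opprB.
    by apply: le_trans (le_normcD _ _); rewrite addrA subrK.
  by apply/andP; split; lra.
have cval : continuous (set_val : circle R -> R[i]^o).
  exact: (@initial_continuous _ _ (set_val : circle R -> R[i]^o)).
move=> xi.
exact: (@continuous_comp (circle R) R[i]^o R set_val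
  (fun z => normc (z - circle_val zeta)) xi (cval xi) (cv _)).
Qed.

Lemma measurable_circle_dist zeta : measurable_fun setT (circle_dist zeta).
Proof.
apply: (measurability _ (RGenOpens.measurableE R)) => //.
move=> _ [_ [a [b ->] <-]]; rewrite setTI; apply: sub_sigma_algebra.
apply: open_comp; last exact: interval_open.
by move=> xi _; exact: continuous_circle_dist.
Qed.

End circle.

(** * Measure of arcs and mean of the Poisson kernel *)

Section circle_measure_estimates.
Context (R : realType).
Implicit Types (t x : R) (xi zeta : circle R).

Lemma sin_le_id t : 0 <= t -> sin t <= t.
Proof.
rewrite le_eqVlt => /predU1P[<-|t0]; first by rewrite sin0.
have [c _] := MVT t0 (fun x _ => is_derive_sin x)
  (continuous_subspaceT (@continuous_sin R)).
by rewrite sin0 !subr0 => ->; rewrite ler_piMl ?cos_le1// ltW.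
Qed.

(** [2 - 2 cos t = 4 sin^2 (t / 2)], and [|sin y| <= |y|]. *)
Lemma chord_le t : 2 - 2 * cos t <= t ^+ 2.
Proof.
wlog t0 : t / 0 <= t => [h|].
  have [/h//|/ltW t0] := leP 0 t.
  by rewrite -cosN -sqrrN h// oppr_ge0.
have e : t = (t / 2) *+ 2 by rewrite -mulr_natr divfK.
have h : sin (t / 2) ^+ 2 <= (t / 2) ^+ 2.
  have t2 : 0 <= t / 2 by rewrite divr_ge0.
  rewrite -(real_normK (num_real (sin _))) lerXn2r ?nnegrE// ler_norml.
  rewrite sin_le_id// andbT.
  have [t1|t1] := leP (t / 2) pi.
    by rewrite (le_trans _ (sin_ge0_pi _)) ?oppr_le0 ?t2.
  by rewrite (le_trans _ (sin_geN1 _))// lerN2 (le_trans _ (ltW t1))// (le_trans _ (@pi_ge2 R))// ler1n.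
rewrite {1}e cos_mulr2n cos2sin2; move: h; rewrite expr_div_n.
move: (sin _ ^+ 2) (t ^+ 2) => S T; rewrite -mulr_natr; lra.
Qed.

(** A chord shorter than 1 forces [cos (t / 2) > 1/2]; then the mean value theorem gives
    [sin y >= y / 2] at [y = |t| / 2], and the chord is [2 sin y]. *)
Lemma chord_ge t r : `|t| <= pi -> 0 < r -> r <= 1 -> 2 - 2 * cos t < r ^+ 2 ->
  `|t| <= 2 * r.
Proof.
rewrite -cos_norm; move: `|t| (normr_ge0 t) => {}t; rewrite le_eqVlt.
move=> /predU1P[<- _ r0 _ _|t0 tpi r0 r1 h]; first by rewrite mulr_ge0// ltW.
have e : t = (t / 2) *+ 2 by rewrite -mulr_natr divfK.
set y := t / 2 in e; have y0 : 0 < y by rewrite divr_gt0.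
have ypi : y <= pi / 2 by rewrite ler_pM2r.
have cy0 : 0 <= cos y by rewrite cos_ge0_pihalf// ypi andbT (le_trans _ (ltW y0))// oppr_le0 divr_ge0// pi_ge0.
have rr : r ^+ 2 <= 1 by rewrite expr_le1// ltW.
have ct : cos t = 2 * cos y ^+ 2 - 1 by rewrite {1}e cos_mulr2n mulr_natl.
have cy : 1 / 2 < cos y.
  rewrite -(@ltr_pXn2r _ 2) ?nnegrE//; rewrite expr_div_n expr1n.
  by move: h; rewrite ct; move: (cos y ^+ 2) => C; rewrite expr2; lra.
have [c] := MVT y0 (fun x _ => is_derive_sin x)
  (continuous_subspaceT (@continuous_sin R)).
rewrite in_itv/= sin0 !subr0 => /andP[c0 cy1] sE.
have pi0 := pi_gt0 R.
have cc : cos y < cos c.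
  by rewrite ltr_cos ?in_itv/=; [|apply/andP; split; lra..].
have sy : y / 2 <= sin y.
  by rewrite sE mulrC ler_pM2r//; lra.
have : (2 * sin y) ^+ 2 < r ^+ 2.
  move: h; rewrite ct exprMn sin2cos2; move: (cos y ^+ 2) => C; rewrite (expr2 2); lra.
rewrite ltr_pXn2r ?nnegrE ?(ltW r0)//; last by lra.
rewrite /y in sy *; lra.
Qed.

Lemma poisson_integral rho x : 0 <= rho -> rho < 1 ->
  (\int[lebesgue_measure]_(t in `[0%R, (2 * pi)%R])
     ((1 - rho ^+ 2) / ((1 - rho) ^+ 2 + rho * (2 - 2 * cos (t - x))))%:E
   = (2 * pi)%:E)%E.
Proof.
move=> r0 r1.
have D0 t : 0 < 1 - rho * cos t.
  rewrite subr_gt0 (le_lt_trans _ r1)// ler_piMr// cos_le1//.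
have g0 t : 0 < (1 - rho) ^+ 2 + rho * (2 - 2 * cos t).
  by rewrite ltr_pwDl ?exprn_gt0 ?subr_gt0// mulr_ge0// subr_ge0 ler_piMr// cos_le1.
(* The [atan] is minus the argument of [1 - rho * e^(i (t - x))]: unlike the usual
   half-angle antiderivative, [F] is smooth over the whole period. *)
pose F t : R := t + 2 * atan (rho * sin (t - x) / (1 - rho * cos (t - x))).
have dF t : is_derive t 1 F
    ((1 - rho ^+ 2) / ((1 - rho) ^+ 2 + rho * (2 - 2 * cos (t - x)))).
  set c := cos (t - x); set s := sin (t - x).
  have DN : 1 - rho * c != 0 by rewrite gt_eqF ?D0.
  have GN : (1 - rho) ^+ 2 + rho * (2 - 2 * c) != 0 by rewrite gt_eqF ?g0.
  have s2 : s ^+ 2 = 1 - c ^+ 2 by exact: sin2cos2.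
  have dsh : is_derive t 1 (fun u : R => u - x) 1.
    by apply: is_derive_eq; rewrite oppr0 addr0.
  have dS := @is_derive1_comp R sin (fun u => u - x) t _ _ (is_derive_sin (t - x)) dsh.
  have dC := @is_derive1_comp R cos (fun u => u - x) t _ _ (is_derive_cos (t - x)) dsh.
  have dN := is_deriveZ rho dS.
  have dD := is_deriveB (is_derive_cst (1 : R) t 1) (is_deriveZ rho dC).
  have dV := @is_deriveV _ (fun u => 1 - rho * cos (u - x)) t _ 1 DN dD.
  have dQ := is_deriveM dN dV.
  have dA := @is_derive1_comp R atan
    (fun u => rho * sin (u - x) * (1 - rho * cos (u - x))^-1) t _ _
    (is_derive1_atan _) dQ.
  apply: (is_derive_eq (is_deriveD (is_derive_id t 1) (is_deriveZ 2 dA))).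
  rewrite /GRing.scale/= -/s -/c (_ : rho *: s = rho * s)//.
  have -> : (1 + (rho * s * (1 - rho * c)^-1) ^+ 2)^-1 =
      (1 - rho * c) ^+ 2 / ((1 - rho) ^+ 2 + rho * (2 - 2 * c)).
    have GE : (1 - rho) ^+ 2 + rho * (2 - 2 * c) =
        (1 - rho * c) ^+ 2 + rho ^+ 2 * s ^+ 2 by rewrite s2; ring.
    rewrite GE in GN *.
    have -> : 1 + (rho * s / (1 - rho * c)) ^+ 2 =
        ((1 - rho * c) ^+ 2 + rho ^+ 2 * s ^+ 2) / (1 - rho * c) ^+ 2 by field.
    by rewrite invf_div.
  transitivity (1 + 2 * (rho * c * (1 - rho * c) - rho ^+ 2 * s ^+ 2) /
     ((1 - rho) ^+ 2 + rho * (2 - 2 * c))); first by field; rewrite DN GN.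
  by rewrite s2; field.
have cF : continuous F.
  by move=> t; apply/differentiable_continuous/derivable1_diffP.
rewrite (@continuous_FTC2 _ _ F).
(* The [atan] terms at the two ends agree by periodicity, so only the increment of the linear term
   of [F] remains. *)
- rewrite /F -EFinB; congr EFin.
  have -> : sin (2 * pi - x) = sin (0 - x).
    by rewrite mulr_natl addrC sinD2pi sub0r.
  have -> : cos (2 * pi - x) = cos (0 - x).
    by rewrite mulr_natl addrC cosD2pi sub0r.
  by rewrite !add0r addrK.
- exact: pi2_gt0.
- apply: continuous_subspaceT => t.
  apply: cvgM; first exact: cvg_cst.
  apply: cvgV; first by rewrite gt_eqF ?g0.
  apply: cvgD; first exact: cvg_cst.
  apply: cvgM; first exact: cvg_cst.
  apply: cvgB; first exact: cvg_cst.
  apply: cvgM; first exact: cvg_cst.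
  apply: continuous_comp; last exact: continuous_cos.
  by apply: cvgB; [exact: cvg_id|exact: cvg_cst].
- split.
  + by move=> t _; exact: ex_derive.
  + by apply: cvg_at_right_filter; exact: cF.
  + by apply: cvg_at_left_filter; exact: cF.
- by move=> t _; rewrite derive1E; apply: derive_val.
Qed.

Lemma measurable_poisson_kernel rho zeta :
  0 <= rho -> measurable_fun setT (poisson_kernel (real_complex R rho * circle_val zeta)).
Proof.
move=> r0; rewrite (_ : poisson_kernel _ = fun xi => (1 - rho ^+ 2) *
    ((1 - rho) ^+ 2 + rho * circle_dist zeta xi ^+ 2) `^ (-1)).
  apply: measurable_funM => //; apply: (measurableT_comp (measurable_powR _)).
  apply: measurable_funD => //; apply: measurable_funM => //.
  by apply: measurable_funX; exact: measurable_circle_dist.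
apply/funext => xi; rewrite poisson_kernelE powR_inv1//.
by rewrite addr_ge0 ?sqr_ge0// mulr_ge0 ?sqr_ge0.
Qed.

Lemma measurable_circle_ball zeta r :
  measurable [set xi | circle_dist zeta xi < r].
Proof.
have := measurable_circle_dist zeta measurableT (measurable_itv `]-oo, r[).
by rewrite setTI; congr measurable; apply/seteqP; split => x /=; rewrite in_itv.
Qed.

Lemma measurable_expi_preimage (A : set (circle R)) : measurable A ->
  measurable ((@expi R @^-1` A) `&` `[0%R, (2 * pi)%R]).
Proof.
move=> mA; apply: measurableI => //.
by rewrite -[X in measurable X]setTI; exact: measurable_expi.
Qed.

Lemma circle_measureE (A : set (circle R)) : measurable A ->
  circle_measure R A =
  ((2 * pi)^-1%:E * lebesgue_measure ((@expi R @^-1` A) `&` `[0%R, (2 * pi)%R]))%E.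
Proof.
move=> mA; rewrite /circle_measure/= /distribution /pushforward/= /uniform_prob.
rewrite integral_uniform_pdf.
have mE := measurable_expi_preimage mA.
rewrite -integral_cst//; apply: eq_integral => t /set_mem[_ /=].
by rewrite in_itv/= /uniform_pdf subr0 => ->.
Qed.

Lemma circle_ball_le zeta r : 0 < r ->
  (circle_measure R [set xi | circle_dist zeta xi < r]%R <= (3 * r)%:E)%E.
Proof.
move=> r0; have [r1|r1] := leP 1 r.
  apply: (le_trans (probability_le1 _ (measurable_circle_ball _ _))).
  by rewrite lee_fin; lra.
have [x [x0 x2 ->]] := circle_expi zeta.
have mB := measurable_circle_ball (expi x) r.
rewrite circle_measureE//.
have pi0 := pi_gt0 R; have pi2 := pi_ge2 R.
(* The difference [t - x] ranges over [[-2 pi, 2 pi]]; adding [0], [2 pi] or [-2 pi] brings it into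
   [[-pi, pi]], where [chord_ge] applies. The three intervals have total length [12 r], and
   [pi >= 2] yields the factor 3. *)
pose I (c : R) : set R := `[c - 2 * r, c + 2 * r]%classic.
have lI c : (lebesgue_measure (I c) <= (4 * r)%:E)%E.
  rewrite lebesgue_measure_itv/= lte_fin ifT; last by lra.
  by rewrite -EFinB lee_fin; lra.
have sub : (@expi R @^-1` [set xi | circle_dist (expi x) xi < r]) `&` `[0%R, (2 * pi)%R]
    `<=` I x `|` I (x + 2 * pi) `|` I (x - 2 * pi).
  move=> t [/= dt]; rewrite in_itv/= => /andP[t0 t2].
  have key u : `|u| <= pi -> cos u = cos (t - x) -> - (2 * r) <= u <= 2 * r.
    move=> upi cu; rewrite -ler_norml; apply: chord_ge => //; first exact: ltW.
    by rewrite cu -circle_dist_expi ltr_pXn2r ?nnegrE ?circle_dist_ge0 ?(ltW r0).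
  have [h|h] := leP (t - x) pi; first have [h'|h'] := leP (- pi) (t - x).
  - left; left; rewrite /I/= in_itv/=.
    have /andP[k1 k2] := key (t - x) (etrans (ler_norml _ _) (introT andP (conj h' h))) erefl.
    by apply/andP; split; lra.
  - right; rewrite /I/= in_itv/=.
    have /andP[k1 k2] : - (2 * r) <= t - x + 2 * pi <= 2 * r.
      apply: key; last by rewrite mulr_natl cosD2pi.
      by rewrite ler_norml; apply/andP; split; lra.
    by apply/andP; split; lra.
  - left; right; rewrite /I/= in_itv/=.
    have /andP[k1 k2] : - (2 * r) <= t - x - 2 * pi <= 2 * r.
      apply: key; last by rewrite -[in RHS](subrK (2 * pi) (t - x)) mulr_natl cosD2pi.
      by rewrite ler_norml; apply/andP; split; lra.
    by apply/andP; split; lra.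
have lsub : (lebesgue_measure ((@expi R @^-1` [set xi | circle_dist (expi x) xi < r]%R)
    `&` `[0%R, (2 * pi)%R]) <= (12 * r)%:E)%E.
  have mI c : measurable (I c) by exact: measurable_itv.
  apply: (@le_trans _ _ (lebesgue_measure (I x `|` I (x + 2 * pi) `|` I (x - 2 * pi)))).
    apply: le_measure sub; rewrite inE; first exact: measurable_expi_preimage.
    by apply: measurableU; [apply: measurableU|]; exact: mI.
  have mI2 : measurable (I x `|` I (x + 2 * pi)) by apply: measurableU; exact: mI.
  have U1 := @measureU2 _ _ _ (@lebesgue_measure R) _ _ mI2 (mI (x - 2 * pi)).
  have U2 := @measureU2 _ _ _ (@lebesgue_measure R) _ _ (mI x) (mI (x + 2 * pi)).
  apply: (le_trans U1).
  apply: (@le_trans _ _ ((4 * r)%:E + (4 * r)%:E + (4 * r)%:E)%E).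
    apply: leeD; last exact: lI.
    by apply: (le_trans U2); apply: leeD; exact: lI.
  by rewrite -!EFinD lee_fin; lra.
apply: (@le_trans _ _ ((2 * pi)^-1%:E * (12 * r)%:E)%E).
  by rewrite lee_wpmul2l// lee_fin invr_ge0 mulr_ge0// ltW.
rewrite -EFinM lee_fin mulrC ler_pdivrMr ?mulr_gt0//.
have := ler_wpM2l (ltW r0) pi2; lra.
Qed.

Lemma circle_ball_ge zeta r : 0 < r -> r <= 2 ->
  ((r / 8)%:E <= circle_measure R [set xi | circle_dist zeta xi < r]%R)%E.
Proof.
move=> r0 r2; have [x [x0 x2 ->]] := circle_expi zeta.
have mB := measurable_circle_ball (expi x) r.
rewrite circle_measureE//.
have pi0 := pi_gt0 R; have pi2 := pi_ge2 R; have pi4 := pihalf_lt2 R.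
have key t : 0 <= t -> t <= 2 * pi -> `|t - x| < r ->
    ((@expi R @^-1` [set xi | circle_dist (expi x) xi < r]) `&` `[0%R, (2 * pi)%R]) t.
  move=> t0 t2 tx; split; last by rewrite /= in_itv/= t0.
  apply: le_lt_trans tx.
  rewrite -(@ler_pXn2r _ 2) ?nnegrE ?circle_dist_ge0// circle_dist_expi.
  by rewrite real_normK ?num_real// chord_le.
apply: (@le_trans _ _ ((2 * pi)^-1%:E * r%:E)%E).
  rewrite -EFinM lee_fin mulrC ler_pM2r// lef_pV2 ?posrE ?mulr_gt0//.
  by move: pi4; rewrite ltr_pdivrMr//; lra.
rewrite lee_wpmul2l//; first by rewrite lee_fin invr_ge0 mulr_ge0// ltW.
have mE := measurable_expi_preimage mB.
(* A one-sided interval of length [r] is enough. Taken on the side of [pi], it stays inside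
   [[0, 2 pi]] because [r <= 2 <= pi]. *)
have [xpi|xpi] := leP x pi.
  have <- : lebesgue_measure (`]x, (x + r)[%classic : set R) = r%:E.
    rewrite lebesgue_measure_itv/= lte_fin ltrDl r0 -EFinB; congr EFin; ring.
  apply: le_measure; rewrite ?inE// => t; rewrite /= in_itv/= => /andP[t1 t2].
  by apply: key; rewrite ?ger0_norm; lra.
have <- : lebesgue_measure (`](x - r), x[%classic : set R) = r%:E.
  by rewrite lebesgue_measure_itv/= lte_fin gtrBl r0 -EFinB; congr EFin; ring.
apply: le_measure; rewrite ?inE// => t; rewrite /= in_itv/= => /andP[t1 t2].
by apply: key; rewrite ?ltr0_norm; lra.
Qed.

Lemma poisson_kernel_integral rho zeta : 0 <= rho -> rho < 1 ->
  (\int[circle_measure R]_xi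
    (poisson_kernel (real_complex R rho * circle_val zeta) xi)%:E = 1)%E.
Proof.
move=> r0 r1.
have mP : measurable_fun setT (fun xi =>
    (poisson_kernel (real_complex R rho * circle_val zeta) xi)%:E).
  by apply/measurable_EFinP; exact: measurable_poisson_kernel.
have P0 xi : 0 <= poisson_kernel (real_complex R rho * circle_val zeta) xi.
  rewrite poisson_kernelE divr_ge0//; first by rewrite subr_ge0 expr_le1// ltW.
  by rewrite addr_ge0 ?sqr_ge0// mulr_ge0 ?sqr_ge0.
rewrite ge0_integral_distribution; last 2 first.
- exact: mP.
- by move=> xi; rewrite lee_fin P0.
rewrite integral_uniform; last 2 first.
- apply: (measurableT_comp mP); exact: measurable_expi.
- by move=> t; rewrite lee_fin P0.
have [x [x0 x2 ->]] := circle_expi zeta.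
under eq_integral do rewrite /= poisson_kernelE circle_dist_expi.
by rewrite poisson_integral// subr0 -EFinM mulVf// gt_eqF// mulr_gt0// pi_gt0.
Qed.

End circle_measure_estimates.

(** * Entropy as an integral of a nonnegative function *)

Section density.
Context d (T : measurableType d) (R : realType).
Variables (m mu : probability T R) (w : T -> R).
Hypotheses (mw : measurable_fun setT w)
  (muw : forall A, measurable A -> mu A = (\int[m]_(x in A) (w x)%:E)%E).

(** [mu] is dominated by [m], and its Radon-Nikodym derivative has the same integral as [w] over
    every measurable set, hence equals [w] almost everywhere; the change of variables formula then
    applies. *)
Lemma integral_density (f : T -> R) : measurable_fun setT f ->
  (forall x, 0 <= f x) ->
  (\int[mu]_x (f x)%:E = \int[m]_x (w x * f x)%:E)%E.
Proof.
move=> mf f0.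
have dom : mu `<< m.
  apply/null_content_dominatesP => A mA mA0; rewrite muw//.
  by apply: null_set_integral => //; exact/measurable_EFinP/measurable_funTS.
rewrite -(@Radon_Nikodym_SigmaFinite.change_of_variables _ _ _ _ _ dom (EFin \o f) setT)//;
  last exact/measurable_EFinP.
set g := Radon_Nikodym_SigmaFinite.f _ _.
have gi : m.-integrable setT g by exact: Radon_Nikodym_SigmaFinite.f_integrable.
have gw : ae_eq m setT g (EFin \o w).
  apply: integral_ae_eq => //; first exact/measurable_EFinP.
  move=> A _ mA; rewrite -muw//; apply/esym.
  exact: Radon_Nikodym_SigmaFinite.f_integral.
apply: ae_eq_integral => //.
- apply: emeasurable_funM; first exact/measurable_EFinP.
  exact: measurable_int gi.
- by apply/measurable_EFinP; exact: measurable_funM.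
- apply: filterS gw => x /= h _.
  by rewrite h// -EFinM mulrC.
Qed.

End density.

(** * The pointwise gap between the logarithm and its tangent *)

Section relative_entropy_integrand.
Context (R : realType).
Implicit Types (B y : R).

(** The Itakura-Saito divergence [y / B - 1 - ln (y / B)], that is, the height at [y] of the tangent
    to [ln] at [B] above [ln]. Extended values let it be [+oo] at [y = 0]. *)
Definition log_gap B y : \bar R := ((ln B + y / B - 1)%:E - lne y%:E)%E.

Lemma log_gap_gt0 B y : 0 < y -> log_gap B y = (ln B + y / B - 1 - ln y)%:E.
Proof. by move=> y0; rewrite /log_gap lne_EFin. Qed.

Lemma ln_le_subr1 y : 0 < y -> ln y <= y - 1.
Proof.
by move=> y0; rewrite -{1}(subrK 1 y) addrC le_ln1Dx// ltrBrDl subrr.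
Qed.

Lemma log_gap_ge0 B y : 0 < B -> 0 <= y -> (0 <= log_gap B y)%E.
Proof.
move=> B0; rewrite le_eqVlt => /predU1P[<-|y0].
  by rewrite /log_gap le0_lneNy//= leey.
rewrite log_gap_gt0// lee_fin.
have := ln_le_subr1 (divr_gt0 y0 B0); rewrite ln_div ?posrE//; lra.
Qed.

(** From [ln x <= x - 1] at [x = B / y], the gap is at most [y / B + B / y - 2]. *)
Lemma log_gap_le B y : 0 < B -> 0 < y ->
  (log_gap B y <= ((y - B) ^+ 2 / (y * B))%:E)%E.
Proof.
move=> B0 y0; rewrite log_gap_gt0// lee_fin.
have := ln_le_subr1 (divr_gt0 B0 y0); rewrite ln_div ?posrE// => h.
have -> : (y - B) ^+ 2 / (y * B) = y / B + B / y - 2 by field; rewrite !gt_eqF.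
lra.
Qed.

(* [ln x = 2 ln (sqrt x) <= 2 (sqrt x - 1)], hence
   [x - 1 - ln x >= (sqrt x - 1)^2]. *)
Lemma log_gap_ge B y : 0 < B -> 0 < y ->
  (((y - B) ^+ 2 / (2 * B * (y + B)))%:E <= log_gap B y)%E.
Proof.
move=> B0 y0; rewrite log_gap_gt0// lee_fin.
set s := Num.sqrt (y / B); have yB : 0 < y / B by rewrite divr_gt0.
have s0 : 0 < s by rewrite sqrtr_gt0.
have s2 : s ^+ 2 = y / B by rewrite sqr_sqrtr// ltW.
have lnE : ln y - ln B = 2 * ln s.
  by rewrite -ln_div ?posrE// -s2 lnXn// mulr_natl.
have := ln_le_subr1 s0 => h.
have yE : y = B * s ^+ 2 by rewrite s2 mulrCA divff ?mulr1// gt_eqF.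
have -> : (y - B) ^+ 2 / (2 * B * (y + B)) =
    (s - 1) ^+ 2 * ((s + 1) ^+ 2 / (2 * (s ^+ 2 + 1))).
  rewrite yE; field; apply/and3P; split; rewrite gt_eqF //.
  - by rewrite ltr_wpDl ?sqr_ge0.
  - by rewrite addr_gt0// mulr_gt0// exprn_gt0.
apply: (@le_trans _ _ ((s - 1) ^+ 2)).
  rewrite ler_piMr ?sqr_ge0// ler_pdivrMr ?mulr_gt0// ?addr_gt0 ?exprn_gt0//.
  have := sqr_ge0 (s - 1); lra.
have -> : y / B = s ^+ 2 by rewrite s2.
rewrite sqrrB; lra.
Qed.

Lemma measurable_lne : measurable_fun setT (fun y : R => lne y%:E).
Proof.
rewrite /lne; apply: measurable_fun_if => //.
  exact: measurable_fun_ler.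
exact/measurable_EFinP/measurable_funTS.
Qed.

End relative_entropy_integrand.

Section entropy_integral.
Context d (T : measurableType d) (R : realType) (m : probability T R).
Variables (w : T -> R).
Hypotheses (mw : measurable_fun setT w) (w0 : forall x, 0 <= w x)
  (intw : (\int[m]_x (w x)%:E = 1)%E)
  (log_intw : (-oo < \int[m]_x lne (w x)%:E)%E).

(** The positive part of the logarithm is below [w], of integral 1; the hypothesis [log_intw] then
    excludes an infinite negative part. *)
Lemma integrable_log_density : m.-integrable setT (fun x => lne (w x)%:E).
Proof.
have ml : measurable_fun setT (fun x => lne (w x)%:E).
  exact: (measurableT_comp (@measurable_lne R)).
have pos : (\int[m]_x (fun x => lne (w x)%:E)^\+ x < +oo)%E.
  apply: (@le_lt_trans _ _ (\int[m]_x (w x)%:E)%E); last by rewrite intw ltry.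
  apply: ge0_le_integral => //.
  - exact/measurable_funepos.
  - exact/measurable_EFinP.
  - move=> x _; rewrite funeposE ge_max lee_fin w0 andbT.
    have := w0 x; rewrite le_eqVlt => /predU1P[<-|wx]; first by rewrite le0_lneNy// leNye.
    by rewrite lne_EFin// lee_fin ltW// ln_sublinear.
apply/integrableP; split => //.
rewrite (_ : (fun x => `|lne (w x)%:E|)%E =
  fun x => ((fun x => lne (w x)%:E)^\+ x + (fun x => lne (w x)%:E)^\- x)%E); last first.
  by apply/funext => x; rewrite -[LHS]/((abse \o (fun x => lne (w x)%:E)) x) fune_abse.
rewrite ge0_integralD//; [|exact/measurable_funepos|exact/measurable_funeneg].
rewrite lte_add_pinfty//.
have h := log_intw; rewrite integralE in h; move: h.
by case: (\int[m]_x _^\- x)%E => [r||]; rewrite ?ltry ?ltNyy// addeNy ltxx.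
Qed.

Variable P : T -> R.
Hypotheses (mP : measurable_fun setT P) (P0 : forall x, 0 <= P x)
  (bP : exists K, forall x, P x <= K) (intP : (\int[m]_x (P x)%:E = 1)%E).

Let A : \bar R := (\int[m]_x (w x * P x)%:E)%E.

Let bounded_P : [bounded P x | x in setT].
Proof.
have [K PK] := bP; exists K; split; first exact: num_real.
by move=> M KM x _; rewrite /= ger0_norm// (le_trans (PK x))// ltW.
Qed.

Let integrable_w : m.-integrable setT (EFin \o w).
Proof.
apply/integrableP; split; first exact/measurable_EFinP.
by under eq_integral do rewrite /= ger0_norm//; rewrite intw ltry.
Qed.

Let integrable_wP : m.-integrable setT (fun x => (w x * P x)%:E).
Proof. exact: (integrableMl measurableT integrable_w mP bounded_P). Qed.

Let integrable_P : m.-integrable setT (EFin \o P).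
Proof.
apply/integrableP; split; first exact/measurable_EFinP.
by under eq_integral do rewrite /= ger0_norm//; rewrite intP ltry.
Qed.

Let integrable_lP : m.-integrable setT (fun x => lne (w x)%:E * (P x)%:E)%E.
Proof. exact: (integrableMl measurableT integrable_log_density mP bounded_P). Qed.

Lemma mean_fin_num : A \is a fin_num.
Proof. exact: integrable_fin_num. Qed.

Lemma log_gap_integral B : 0 < B ->
  (\int[m]_x (log_gap B (w x) * (P x)%:E) =
   (ln B + fine A / B - 1)%:E - \int[m]_x (lne (w x)%:E * (P x)%:E))%E.
Proof.
move=> B0; rewrite (_ : (fun x => _) = (fun x => ((ln B - 1)%:E * (P x)%:E +
    B^-1%:E * (w x * P x)%:E)%E) \- (fun x => lne (w x)%:E * (P x)%:E)%E)%E; last first.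
  apply/funext => x; rewrite /log_gap muleBl//; congr (_ - _)%E.
  by rewrite -!EFinM -EFinD; congr EFin; ring.
rewrite integralB//; last first.
  by apply: integrableD => //; exact: integrableZl.
rewrite integralD//; [|exact: integrableZl..].
rewrite !integralZl// intP -/A -(fineK mean_fin_num) -!EFinM -EFinD.
by congr (_%:E - _)%E; ring.
Qed.

(** When [B] is the [P]-mean of [w], the term [fine A / B - 1] of [log_gap_integral] vanishes. *)
Lemma entropy_integralE : (0 < A)%E ->
  (lne A - \int[m]_x (lne (w x)%:E * (P x)%:E) =
   \int[m]_x (log_gap (fine A) (w x) * (P x)%:E))%E.
Proof.
move=> A0; have a0 : 0 < fine A by rewrite fine_gt0// A0 ltey_eq mean_fin_num.
rewrite log_gap_integral// divff ?gt_eqF// addrK.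
by rewrite -{1}(fineK mean_fin_num) lne_EFin.
Qed.

(** The mean enters [log_gap_integral] through the tangent to [ln] at [B], which lies above [ln]. *)
Lemma entropy_integral_le B : 0 < B -> (0 < A)%E ->
  (lne A - \int[m]_x (lne (w x)%:E * (P x)%:E) <=
   \int[m]_x (log_gap B (w x) * (P x)%:E))%E.
Proof.
move=> B0 A0; have a0 : 0 < fine A by rewrite fine_gt0// A0 ltey_eq mean_fin_num.
rewrite log_gap_integral// -{1}(fineK mean_fin_num) lne_EFin// leeD2r// lee_fin.
have := ln_le_subr1 (divr_gt0 a0 B0); rewrite ln_div ?posrE//; lra.
Qed.

End entropy_integral.

(** * Local estimates *)

Section lincomb.
Context d (T : measurableType d) (R : realType) (m : {measure set T -> \bar R}).
Local Open Scope ereal_scope.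

(** Turns a pointwise bound by a near part and a far part into a bound on integrals. Nonnegativity
    replaces integrability, so the functions may take the value [+oo], as [log_gap] does. *)
Lemma ge0_integral_lincomb_le (f g1 g2 g3 : T -> \bar R) (c1 c2 c3 b1 b2 b3 : R) :
  (0 <= c1)%R -> (0 <= c2)%R -> (0 <= c3)%R ->
  measurable_fun setT f -> measurable_fun setT g1 -> measurable_fun setT g2 ->
  measurable_fun setT g3 -> (forall x, 0 <= f x) -> (forall x, 0 <= g1 x) ->
  (forall x, 0 <= g2 x) -> (forall x, 0 <= g3 x) ->
  (forall x, f x <= c1%:E * g1 x + c2%:E * g2 x + c3%:E * g3 x) ->
  \int[m]_x g1 x <= b1%:E -> \int[m]_x g2 x <= b2%:E -> \int[m]_x g3 x <= b3%:E ->
  \int[m]_x f x <= (c1 * b1 + c2 * b2 + c3 * b3)%:E.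
Proof.
move=> c10 c20 c30 mf mg1 mg2 mg3 f0 g10 g20 g30 fg i1 i2 i3.
have m1 : measurable_fun setT (fun x => c1%:E * g1 x) by exact: measurable_funeM.
have m2 : measurable_fun setT (fun x => c2%:E * g2 x) by exact: measurable_funeM.
have m3 : measurable_fun setT (fun x => c3%:E * g3 x) by exact: measurable_funeM.
have p1 x : 0 <= c1%:E * g1 x by rewrite mule_ge0.
have p2 x : 0 <= c2%:E * g2 x by rewrite mule_ge0.
have p3 x : 0 <= c3%:E * g3 x by rewrite mule_ge0.
apply: (@le_trans _ _ (\int[m]_x (c1%:E * g1 x + c2%:E * g2 x + c3%:E * g3 x))).
  apply: ge0_le_integral => //.
  by apply: emeasurable_funD => //; exact: emeasurable_funD.
rewrite ge0_integralD//; [|by move=> x _; rewrite adde_ge0|exact: emeasurable_funD].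
rewrite ge0_integralD// !ge0_integralZl_EFin// !EFinD !EFinM.
by apply: leeD; [apply: leeD|]; exact: lee_wpmul2l.
Qed.

End lincomb.

Section poisson_dist.
Context d (T : measurableType d) (R : realType).
Variables (m : probability T R) (dist : T -> R) (rho : R).
Hypotheses (reg : ball_regular dist m) (rho_ge : 1 / 2 <= rho) (rho_lt1 : rho < 1).

(** The right-hand side of [poisson_kernelE], with [dist] standing for the distance to [zeta]. *)
Definition poisson_dist (x : T) : R :=
  (1 - rho ^+ 2) / ((1 - rho) ^+ 2 + rho * dist x ^+ 2).

Let e := 1 - rho.

Let rho_ge0 : 0 <= rho.
Proof. by apply: le_trans rho_ge. Qed.

Let e_gt0 : 0 < e.
Proof. by rewrite subr_gt0. Qed.

Let dist_ge0 x : 0 <= dist x.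
Proof. by case: reg => _ /(_ x)/andP[]. Qed.

Let dist_le2 x : dist x <= 2.
Proof. by case: reg => _ /(_ x)/andP[]. Qed.

Let den_gt0 x : 0 < (1 - rho) ^+ 2 + rho * dist x ^+ 2.
Proof. by rewrite ltr_pwDl ?exprn_gt0// mulr_ge0 ?sqr_ge0. Qed.

Let cden_gt0 x : 0 < e ^+ 2 + dist x ^+ 2.
Proof. by rewrite ltr_pwDl ?exprn_gt0// sqr_ge0. Qed.

Let numE : 1 - rho ^+ 2 = e * (1 + rho).
Proof. by rewrite /e; ring. Qed.

Lemma cauchy_le_poisson x : cauchy_kernel dist e x <= poisson_dist x.
Proof.
rewrite /cauchy_kernel /poisson_dist numE; apply: ler_pM.
- exact: ltW.
- by rewrite invr_ge0 ltW.
- by rewrite ler_peMr ?(ltW e_gt0)// lerDl.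
- by rewrite lef_pV2 ?posrE// lerD2l ler_piMl ?sqr_ge0// ltW.
Qed.

Lemma poisson_le_cauchy x : poisson_dist x <= 4 * cauchy_kernel dist e x.
Proof.
rewrite /cauchy_kernel /poisson_dist numE ler_pdivrMr//.
rewrite mulrA [leRHS]mulrAC ler_pdivlMr// [4 * e]mulrC -!mulrA ler_pM2l//.
have := sqr_ge0 e; have := sqr_ge0 (dist x); rewrite -/e.
move: (e ^+ 2) (dist x ^+ 2) => E D D0 E0.
have h1 : (1 + rho) * (E + D) <= 2 * (E + D).
  by rewrite ler_wpM2r ?addr_ge0//; move: rho_lt1; lra.
have h2 : 1 / 2 * D <= rho * D by rewrite ler_wpM2r.
lra.
Qed.

Lemma poisson_dist_far r x : 0 < r -> r <= dist x -> poisson_dist x <= 4 * e / r ^+ 2.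
Proof.
move=> r0 rx; apply: (le_trans (poisson_le_cauchy x)).
rewrite -mulrA ler_pM2l// ler_pM2l// lef_pV2 ?posrE ?exprn_gt0//.
by rewrite (@le_trans _ _ (dist x ^+ 2)) ?lerDr ?sqr_ge0// lerXn2r ?nnegrE// ltW.
Qed.

Lemma poisson_dist_le x : poisson_dist x <= 4 / e.
Proof.
apply: (le_trans (poisson_le_cauchy x)); rewrite ler_pM2l//.
rewrite /cauchy_kernel ler_pdivrMr// ler_pdivlMl// -expr2 lerDl sqr_ge0//.
Qed.

(** The denominator of the Cauchy kernel is at most [1 + 4]. This bound serves to show that the mean
    of [w] against the kernel is positive. *)
Lemma poisson_dist_ge x : e / 5 <= poisson_dist x.
Proof.
apply: le_trans (cauchy_le_poisson x); rewrite ler_pM2l// lef_pV2 ?posrE//.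
have : dist x ^+ 2 <= 2 ^+ 2 by rewrite lerXn2r ?nnegrE.
have : e ^+ 2 <= 1 by rewrite expr_le1 ?(ltW e_gt0)// lerBlDr lerDl.
rewrite (expr2 2); lra.
Qed.

Lemma poisson_dist_ge0 x : 0 <= poisson_dist x.
Proof. by apply: le_trans (poisson_dist_ge x); rewrite divr_ge0// ltW. Qed.

Lemma measurable_poisson_dist : measurable_fun setT poisson_dist.
Proof.
rewrite (_ : poisson_dist = fun x => (1 - rho ^+ 2) *
    ((1 - rho) ^+ 2 + rho * dist x ^+ 2) `^ (-1)).
  apply: measurable_funM => //; apply: (measurableT_comp (measurable_powR _)).
  apply: measurable_funD => //; apply: measurable_funM => //.
  by apply: measurable_funX; case: reg.
by apply/funext => x; rewrite powR_inv1// ltW.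
Qed.

End poisson_dist.

Section local_estimates.
Context d (T : measurableType d) (R : realType).
Implicit Types (m : probability T R) (dist w : T -> R) (s rho e : R).

(** Bundles the data so that the lemmas below can choose their constants from [s], [w0], [a1], [a2],
    [r] alone, before [m], [dist] and [w] are given. *)
Definition power_contact m dist w s (w0 a1 a2 r : R) : Prop :=
  [/\ ball_regular dist m, measurable_fun setT w, (forall x, 0 <= w x),
      (\int[m]_x (w x)%:E = 1)%E &
      forall x, dist x < r ->
        a1 * dist x `^ s <= `|w x - w0| /\ `|w x - w0| <= a2 * dist x `^ s].

Lemma powR_le_min (s y : R) : 0 < s -> 0 <= y -> y <= 2 ->
  y `^ s <= 2 `^ s * y `^ (Num.min s (1 / 2)).
Proof.
move=> s0; rewrite le_eqVlt => /predU1P[<- _|y0 y2].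
  by rewrite powR0 ?gt_eqF// mulr_ge0 ?powR_ge0.
set sg := Num.min s (1 / 2).
have sg0 : 0 < sg by rewrite lt_min s0 divr_gt0.
have sgs : sg <= s by rewrite ge_min lexx.
rewrite -{1}(subrK sg s) powRD ?(gt_eqF y0) ?implybT//.
rewrite ler_wpM2r ?powR_ge0//.
apply: (@le_trans _ _ (2 `^ (s - sg))).
  by apply: ge0_ler_powR; rewrite ?nnegrE ?subr_ge0// ltW.
by rewrite ler_powR ?ler1n// gerBl ltW.
Qed.

Lemma power_poisson_integral_le s : 0 < s -> exists C, 0 < C /\
  forall m dist rho, ball_regular dist m -> 1 / 2 <= rho -> rho < 1 ->
  (\int[m]_x (dist x `^ s * poisson_dist dist rho x)%:E
     <= (C * (1 - rho) `^ (Num.min s (1 / 2)))%:E)%E.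
Proof.
move=> s0; set sg := Num.min s (1 / 2).
have sg0 : 0 < sg by rewrite lt_min s0 divr_gt0.
have sg1 : sg <= 1 / 2 by rewrite ge_min lexx orbT.
have sg2 : 0 < sg / 2 by rewrite divr_gt0.
(* Lowering the exponent from [s] to [sg <= 1/2] costs only a factor, as [dist] is at most 2. Then
   [sg / 2 < 1/2] falls in the pure power regime, with rate [e^sg], whatever [s] is. *)
have [C [C0 CP]] := @kernel_integral_le _ T R (sg / 2) sg2.
exists (2 `^ s * 4 * C); split; first by rewrite !mulr_gt0 ?powR_gt0.
move=> m dist rho reg r2 r1.
have [mdist dist02 _ _] := reg.
have e0 : 0 < 1 - rho by rewrite subr_gt0.
have e2 : 1 - rho <= 1 / 2 by lra.
have := CP m dist _ reg e0 e2.
rewrite /decay_rate ltNge (_ : sg / 2 <= 1 / 2); last by lra.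
rewrite lt_eqF; last by lra.
rewrite mulrCA divff// mulr1 /= subKr => h.
apply: (@le_trans _ _ (\int[m]_x ((2 `^ s * 4)%:E *
    (dist x `^ sg * cauchy_kernel dist (1 - rho) x)%:E))%E).
  apply: ge0_le_integral => //.
  - move=> x _; rewrite lee_fin mulr_ge0 ?powR_ge0//.
    exact: (poisson_dist_ge0 reg).
  - apply/measurable_EFinP; apply: measurable_funM.
      exact: (measurableT_comp (measurable_powR _)).
    exact: (measurable_poisson_dist reg).
  - by apply: measurable_funeM; apply/measurable_EFinP; exact: (measurable_dist_kernel reg).
  - move=> x _; rewrite -EFinM lee_fin.
    rewrite [leRHS]mulrACA; apply: ler_pM.
    + exact: powR_ge0.
    + exact: (poisson_dist_ge0 reg).
    + by have /andP[? ?] := dist02 x; exact: powR_le_min.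
    + exact: poisson_le_cauchy.
rewrite ge0_integralZl_EFin//.
- by rewrite -(mulrA (2 `^ s * 4)) (EFinM (2 `^ s * 4)) lee_wpmul2l// lee_fin mulr_ge0 ?powR_ge0.
- by move=> x _; rewrite lee_fin mulr_ge0 ?powR_ge0// cauchy_kernel_ge0// ltW.
- by apply/measurable_EFinP; exact: (measurable_dist_kernel reg).
Qed.

(** Within distance [r] the error is at most [a2] times the integral of [dist^s] against the kernel.
    Beyond it the kernel is [O(1 - rho)], and both [w] and the constant [w0] have finite
    integral. *)
Lemma mean_near s (w0 a1 a2 r : R) : 0 < s -> 0 < w0 -> 0 < a2 -> 0 < r ->
  exists C, 0 < C /\
  forall m dist w rho, power_contact m dist w s w0 a1 a2 r ->
    1 / 2 <= rho -> rho < 1 -> (\int[m]_x (poisson_dist dist rho x)%:E = 1)%E ->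
  `|fine (\int[m]_x (w x * poisson_dist dist rho x)%:E) - w0|
     <= C * (1 - rho) `^ (Num.min s (1 / 2)).
Proof.
move=> s0 w00 a20 r0; set sg := Num.min s (1 / 2).
have sg0 : 0 < sg by rewrite lt_min s0 divr_gt0.
have sg1 : sg <= 1 / 2 by rewrite ge_min lexx orbT.
have [C [C0 CP]] := power_poisson_integral_le s0; rewrite -/sg in CP.
exists (a2 * C + (1 + w0) * (4 / r ^+ 2)); split.
  by rewrite addr_gt0 ?mulr_gt0 ?invr_gt0 ?exprn_gt0// addr_gt0.
move=> m dist w rho [reg mw w_ge0 intw near] r2 r1 intP.
set e := 1 - rho; have e0 : 0 < e by rewrite subr_gt0.
have P0 x : 0 <= poisson_dist dist rho x by exact: (poisson_dist_ge0 reg).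
have mP := measurable_poisson_dist reg r2 r1.
have mD : measurable_fun setT (fun x => dist x `^ s * poisson_dist dist rho x).
  apply: measurable_funM => //; case: (reg) => mdist _ _ _.
  exact: (measurableT_comp (measurable_powR _)).
have bP : exists K, forall x, poisson_dist dist rho x <= K.
  by exists (4 / e) => x; exact: poisson_dist_le.
have fin := mean_fin_num mw w_ge0 intw mP P0 bP.
set A := fine _; set D := C * e `^ sg.
have iD : (\int[m]_x (dist x `^ s * poisson_dist dist rho x)%:E <= D%:E)%E by exact: CP.
set F := 4 * e / r ^+ 2; have F0 : 0 <= F.
  by rewrite divr_ge0 ?sqr_ge0// mulr_ge0// ltW.
have far x : r <= dist x -> poisson_dist dist rho x <= F by exact: (poisson_dist_far reg).
have iA : (\int[m]_x (w x * poisson_dist dist rho x)%:E = A%:E)%E by rewrite fineK.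
have up : A <= w0 * 1 + a2 * D + F * 1.
  rewrite -lee_fin -iA.
  apply: (ge0_integral_lincomb_le (g1 := fun x => (poisson_dist dist rho x)%:E)
    (g2 := fun x => (dist x `^ s * poisson_dist dist rho x)%:E)
    (g3 := fun x => (w x)%:E)) => //; rewrite ?intP ?intw//.
  - exact: ltW.
  - exact: ltW.
  - by apply/measurable_EFinP; exact: measurable_funM.
  - exact/measurable_EFinP.
  - exact/measurable_EFinP.
  - exact/measurable_EFinP.
  - by move=> x; rewrite lee_fin mulr_ge0.
  - by move=> x; rewrite lee_fin mulr_ge0 ?powR_ge0.
  - move=> x; rewrite -!EFinM -!EFinD lee_fin (mulrA a2) -mulrDl.
    have [dx|dx] := ltP (dist x) r.
      apply: ler_wpDr; first exact: mulr_ge0.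
      apply: ler_wpM2r; first exact: P0.
      by have [_] := near x dx; rewrite ler_norml => /andP[_]; lra.
    apply: ler_wpDl; last by rewrite mulrC; apply: ler_wpM2r => //; exact: far.
    by apply: mulr_ge0 => //; rewrite addr_ge0 ?mulr_ge0 ?powR_ge0 ?(ltW w00) ?(ltW a20).
have down : w0 <= 1 * A + a2 * D + (w0 * F) * 1.
  rewrite -lee_fin.
  have -> : w0%:E = (\int[m]_x (w0 * poisson_dist dist rho x)%:E)%E.
    under eq_integral do rewrite EFinM.
    rewrite ge0_integralZl_EFin ?(ltW w00)//; last 2 first.
    - by move=> x _; rewrite lee_fin.
    - exact/measurable_EFinP.
    by rewrite intP mule1.
  apply: (ge0_integral_lincomb_le (g1 := fun x => (w x * poisson_dist dist rho x)%:E)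
    (g2 := fun x => (dist x `^ s * poisson_dist dist rho x)%:E)
    (g3 := cst 1%:E)) => //; rewrite ?iA//.
  - exact: ltW.
  - by rewrite mulr_ge0// ltW.
  - by apply/measurable_EFinP; exact: measurable_funM.
  - by apply/measurable_EFinP; exact: measurable_funM.
  - exact/measurable_EFinP.
  - by move=> x; rewrite lee_fin mulr_ge0// ltW.
  - by move=> x; rewrite lee_fin mulr_ge0.
  - by move=> x; rewrite lee_fin mulr_ge0 ?powR_ge0.
  - move=> x; rewrite -!EFinM -!EFinD lee_fin mul1r mulr1 (mulrA a2) -mulrDl.
    have [dx|dx] := ltP (dist x) r.
      apply: ler_wpDr; first exact: mulr_ge0 (ltW w00) F0.
      apply: ler_wpM2r; first exact: P0.
      by have [_] := near x dx; rewrite ler_norml => /andP[+ _]; lra.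
    apply: ler_wpDl; last by apply: ler_wpM2l (far _ dx); exact: ltW.
    by apply: mulr_ge0 => //; rewrite addr_ge0 ?mulr_ge0 ?powR_ge0 ?(ltW a20).
  - by rewrite integral_cst// mul1e; exact: probability_le1.
(* The far contribution is linear in [e], hence absorbed by [e^sg], because [e <= 1] and
   [sg <= 1]. *)
have eF : F <= 4 / r ^+ 2 * e `^ sg.
  rewrite /F mulrAC ler_pM2l ?divr_gt0 ?exprn_gt0//.
  rewrite -[leLHS](powRr1 (ltW e0)); apply: ger_powR; last by lra.
  by rewrite e0 /e; lra.
have es0 := powR_ge0 e sg.
have w0F : w0 * F <= w0 * (4 / r ^+ 2 * e `^ sg) by rewrite ler_wpM2l// ltW.
have w0F0 : 0 <= w0 * F by rewrite mulr_ge0// ltW.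
rewrite ler_norml; apply/andP; split.
  move: down w0F; rewrite /D mulrDl mulrDl; lra.
move: up w0F; rewrite /D mulrDl mulrDl; lra.
Qed.

End local_estimates.

(** * Upper and lower bounds for the entropy *)

Section entropy_estimates.
Context d (T : measurableType d) (R : realType).
Implicit Types (m : probability T R) (dist w : T -> R) (s rho e : R).

Lemma measurable_log_gap (B : R) w : measurable_fun setT w ->
  measurable_fun setT (fun x => log_gap B (w x)).
Proof.
move=> mw; apply: emeasurable_funB.
  apply/measurable_EFinP; apply: measurable_funB => //; apply: measurable_funD => //.
  exact: measurable_funM.
exact: (measurableT_comp (@measurable_lne R)).
Qed.

Lemma powR_le_root (s K e : R) : 0 < s -> 0 <= K -> 0 <= e -> e <= K `^ (1 / s) ->
  e `^ s <= K.
Proof.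
move=> s0 K0 e0 eK.
have -> : K = (K `^ (1 / s)) `^ s by rewrite -powRrM mul1r mulVf ?gt_eqF// powRr1.
by apply: ge0_ler_powR; rewrite ?nnegrE ?powR_ge0// ltW.
Qed.

Lemma powR_sqr (y s : R) : (y `^ s) ^+ 2 = y `^ (2 * s).
Proof. by rewrite -powR_mulrn ?powR_ge0// -powRrM mulrC. Qed.

Lemma power_contact_near m dist w s (w0 a1 a2 r : R) x : 0 < s -> 0 < a2 ->
  a2 * r `^ s <= w0 / 2 -> power_contact m dist w s w0 a1 a2 r ->
  dist x < r -> w0 / 2 <= w x /\ w x <= w0 + w0 / 2.
Proof.
move=> s0 a20 a2r [[_ dist02 _ _] _ _ _ near] dx; have [_] := near x dx.
have /andP[d0 _] := dist02 x.
have : a2 * dist x `^ s <= a2 * r `^ s.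
  rewrite ler_pM2l//; apply: ge0_ler_powR; rewrite ?nnegrE ?(ltW s0) ?(ltW dx)//.
  by rewrite (le_trans d0)// ltW.
move=> h1 h2; have : `|w x - w0| <= w0 / 2 by lra.
by rewrite ler_norml => /andP[? ?]; split; lra.
Qed.

(** The entropy is the integral of a nonnegative gap at [B = A], so it may be restricted to the
    annulus. There [|w - w0| >= a1 t^s >= 2 C], and [|A - w0| <= C], so [|w - A|] is at least half
    of [a1 dist^s]. *)
Lemma entropy_ge_annulus s (w0 a1 a2 r C t : R) m dist w rho :
  0 < s -> 0 < w0 -> 0 < a1 -> 0 < a2 -> 0 <= t -> a2 * r `^ s <= w0 / 2 ->
  power_contact m dist w s w0 a1 a2 r -> (-oo < \int[m]_x lne (w x)%:E)%E ->
  1 / 2 <= rho -> rho < 1 -> (\int[m]_x (poisson_dist dist rho x)%:E = 1)%E ->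
  `|fine (\int[m]_x (w x * poisson_dist dist rho x)%:E) - w0| <= C ->
  C <= w0 / 2 -> 2 * C <= a1 * t `^ s ->
  ((a1 ^+ 2 / (36 * w0 ^+ 2))%:E *
    \int[m]_(x in annulus dist t r)
      (dist x `^ (2 * s) * cauchy_kernel dist (1 - rho) x)%:E
   <= lne (\int[m]_x (w x * poisson_dist dist rho x)%:E) -
      \int[m]_x (lne (w x)%:E * (poisson_dist dist rho x)%:E))%E.
Proof.
move=> s0 w00 a10 a20 t0 a2r con logw r2 r1 intP AC C1 C2.
have [reg mw w_ge0 intw near] := con.
have e0 : 0 < 1 - rho by rewrite subr_gt0.
have P0 x : 0 <= poisson_dist dist rho x by exact: (poisson_dist_ge0 reg).
have mP := measurable_poisson_dist reg r2 r1.
have bP : exists K, forall x, poisson_dist dist rho x <= K.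
  by exists (4 / (1 - rho)) => x; exact: poisson_dist_le.
have fin := mean_fin_num mw w_ge0 intw mP P0 bP.
set Ae := (\int[m]_x (w x * poisson_dist dist rho x)%:E)%E in AC fin *.
set A := fine Ae in AC *.
have [A1 A2] : w0 / 2 <= A /\ A <= w0 + w0 / 2.
  by move: AC; rewrite ler_norml => /andP[? ?]; split; lra.
have A0 : 0 < A by apply: lt_le_trans A1; rewrite divr_gt0.
have Ae0 : (0 < Ae)%E by rewrite -(fineK fin) lte_fin.
rewrite (entropy_integralE mw w_ge0 intw logw mP P0 bP intP Ae0) -/Ae -/A.
set k := _ / _; have k0 : 0 <= k by rewrite divr_ge0 ?sqr_ge0// mulr_ge0 ?sqr_ge0.
have mA := measurable_annulus reg t r.
have mgap : measurable_fun setT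
    (fun x => log_gap A (w x) * (poisson_dist dist rho x)%:E)%E.
  by apply: emeasurable_funM; [exact: measurable_log_gap|exact/measurable_EFinP].
have gap0 x : (0 <= log_gap A (w x) * (poisson_dist dist rho x)%:E)%E.
  by rewrite mule_ge0 ?log_gap_ge0 ?lee_fin.
apply: (@le_trans _ _ (\int[m]_(x in annulus dist t r)
    (log_gap A (w x) * (poisson_dist dist rho x)%:E))%E); last first.
  by apply: ge0_subset_integral.
have mK := measurable_dist_kernel reg (2 * s) (1 - rho).
have K0 x : 0 <= dist x `^ (2 * s) * cauchy_kernel dist (1 - rho) x.
  by rewrite mulr_ge0 ?powR_ge0// cauchy_kernel_ge0// ltW.
rewrite -ge0_integralZl_EFin//; last 2 first.
- by move=> x _; rewrite lee_fin.
- exact/measurable_EFinP/measurable_funTS.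
apply: ge0_le_integral => //.
- by move=> x _; rewrite mule_ge0// lee_fin.
- by apply: measurable_funeM; apply/measurable_EFinP/measurable_funTS.
- exact: measurable_funTS.
move=> x; rewrite /annulus/= => /andP[tx xr].
have [w1 w2] := power_contact_near s0 a20 a2r con xr.
have wx0 : 0 < w x by apply: lt_le_trans w1; rewrite divr_gt0.
have [n1 _] := near x xr.
have d0 : 0 <= dist x by exact: le_trans tx.
have h1 : a1 * t `^ s <= a1 * dist x `^ s.
  by rewrite ler_pM2l//; apply: ge0_ler_powR; rewrite ?nnegrE// ltW.
have wA : a1 * dist x `^ s / 2 <= `|w x - A|.
  have : `|w x - w0| <= `|w x - A| + `|A - w0| by rewrite ler_distD.
  lra.
have wA2 : (a1 ^+ 2 / 4) * dist x `^ (2 * s) <= (w x - A) ^+ 2.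
  rewrite -(real_normK (num_real (w x - A))) -powR_sqr.
  have -> : a1 ^+ 2 / 4 * (dist x `^ s) ^+ 2 = (a1 * dist x `^ s / 2) ^+ 2 by field.
  by rewrite lerXn2r ?nnegrE// divr_ge0// mulr_ge0 ?powR_ge0// ltW.
rewrite (EFinM (dist x `^ _)) muleA; apply: lee_pmul => //; rewrite ?lee_fin.
- by rewrite mulr_ge0 ?powR_ge0.
- by rewrite cauchy_kernel_ge0// ltW.
- apply: le_trans (log_gap_ge A0 wx0); rewrite lee_fin.
  have den0 : 0 < 2 * A * (w x + A) by rewrite !mulr_gt0// addr_gt0.
  (* Both [A] and [w x] are at most [3 w0 / 2]. The 36 in the final constant is this 9 times the 4
     from squaring the half in [wA]. *)
  have den : 2 * A * (w x + A) <= 9 * w0 ^+ 2.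
    have -> : 9 * w0 ^+ 2 = 2 * (w0 + w0 / 2) * ((w0 + w0 / 2) + (w0 + w0 / 2)) by field.
    apply: ler_pM; rewrite ?mulr_ge0 ?addr_ge0 ?(ltW A0) ?(ltW wx0)//.
    + by rewrite ler_pM2l.
    + exact: lerD.
  rewrite ler_pdivlMr// /k.
  apply: le_trans wA2.
  have -> : a1 ^+ 2 / 4 * dist x `^ (2 * s) =
      a1 ^+ 2 / (36 * w0 ^+ 2) * dist x `^ (2 * s) * (9 * w0 ^+ 2).
    by field; rewrite gt_eqF.
  by apply: ler_wpM2l => //; rewrite mulr_ge0 ?powR_ge0.
- exact: cauchy_le_poisson.
Qed.

Lemma entropy_lower s (w0 a1 a2 r : R) : 0 < s -> 0 < w0 -> 0 < a1 -> 0 < a2 ->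
  0 < r -> r <= 1 -> a2 * r `^ s <= w0 / 2 ->
  exists c e0, [/\ 0 < c, 0 < e0 &
  forall m dist w rho, power_contact m dist w s w0 a1 a2 r ->
    (-oo < \int[m]_x lne (w x)%:E)%E ->
    1 / 2 <= rho -> rho < 1 -> 1 - rho < e0 ->
    (\int[m]_x (poisson_dist dist rho x)%:E = 1)%E ->
  ((c * decay_rate s rho)%:E <= lne (\int[m]_x (w x * poisson_dist dist rho x)%:E) -
      \int[m]_x (lne (w x)%:E * (poisson_dist dist rho x)%:E))%E].
Proof.
move=> s0 w00 a10 a20 r0 r1 a2r.
have [C [C0 CP]] := @mean_near _ T R s w0 a1 a2 r s0 w00 a20 r0.
set k := a1 ^+ 2 / (36 * w0 ^+ 2).
have k0 : 0 < k by rewrite divr_gt0 ?mulr_gt0 ?exprn_gt0.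
have [s2|s2] := leP s (1 / 2).
(* Chosen so that [2 C e^s <= a1 (M e)^s]: beyond distance [M e], the deviation of [w] from [w0] is
   at least twice the bound on that of the mean. *)
- pose M := Num.max 1 ((2 * C / a1) `^ (1 / s)).
  have M1 : 1 <= M by rewrite le_max lexx.
  have M0 : 0 < M by exact: lt_le_trans M1.
  have Ms : 2 * C / a1 <= M `^ s.
    have -> : 2 * C / a1 = ((2 * C / a1) `^ (1 / s)) `^ s.
      by rewrite -powRrM mul1r mulVf ?gt_eqF// powRr1// divr_ge0 ?(ltW a10)// mulr_ge0// ltW.
    apply: ge0_ler_powR; rewrite ?nnegrE ?powR_ge0 ?(ltW s0) ?(ltW M0)//.
    by rewrite le_max lexx orbT.
  have [c [e0 [c0 e00 H]]] := @kernel_integral_ge_small _ T R s M r s0 s2 M1 r0 r1.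
  exists (k * c), (Num.min e0 ((w0 / 2 / C) `^ (1 / s))); split.
  + exact: mulr_gt0.
  + by rewrite lt_min e00 powR_gt0// !divr_gt0.
  move=> m dist w rho con logw r2 rl1; rewrite lt_min => /andP[ee0 eE] intP.
  have e_gt0 : 0 < 1 - rho by rewrite subr_gt0.
  have [reg _ _ _ _] := con.
  have := CP m dist w rho con r2 rl1 intP; rewrite (min_idPl s2) => AC.
  have es : (1 - rho) `^ s <= w0 / 2 / C.
    by apply: powR_le_root; rewrite ?(ltW e_gt0) ?(ltW eE)// !divr_ge0// ltW.
  have := @entropy_ge_annulus s w0 a1 a2 r _ (M * (1 - rho)) m dist w rho s0 w00 a10 a20
    _ a2r con logw r2 rl1 intP AC _ _.
  have := H m dist (1 - rho) reg e_gt0 ee0; rewrite subKr => h1 h2.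
  apply: le_trans (h2 _ _ _).
  + by rewrite -/k -mulrA EFinM lee_wpmul2l// lee_fin ltW.
  + by rewrite mulr_ge0// ltW.
  + by rewrite mulrC -ler_pdivlMr.
  + rewrite powRM ?(ltW M0) ?(ltW e_gt0)// !mulrA ler_wpM2r ?powR_ge0//.
    by rewrite [leRHS]mulrC -ler_pdivrMr.
have [c [e0 [c0 e00 H]]] := @kernel_integral_ge_large _ T R s r s0 s2 r0 r1.
have t0 : 0 < r / 32 by rewrite divr_gt0.
(* For [s > 1/2] the mean is only known within [C e^(1/2)] of [w0]. Keeping [e^(1/2)] below [K]
   makes this error at most [w0 / 2] and at most half of [a1 (r / 32)^s], the least deviation of [w]
   guaranteed on the fixed annulus. *)
pose K := Num.min (w0 / 2 / C) (a1 * (r / 32) `^ s / (2 * C)).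
have K0 : 0 < K by rewrite lt_min !divr_gt0// ?mulr_gt0 ?powR_gt0.
have hf : 0 < 1 / 2 :> R by rewrite divr_gt0.
exists (k * c), (Num.min e0 (K `^ (1 / (1 / 2)))); split.
- exact: mulr_gt0.
- by rewrite lt_min e00 powR_gt0.
move=> m dist w rho con logw r2 rl1; rewrite lt_min => /andP[ee0 eE] intP.
have e_gt0 : 0 < 1 - rho by rewrite subr_gt0.
have [reg _ _ _ _] := con.
have := CP m dist w rho con r2 rl1 intP; rewrite (min_idPr (ltW s2)) => AC.
have eK : (1 - rho) `^ (1 / 2) <= K.
  by apply: (powR_le_root hf) => //; exact: ltW.
have /andP[eK1 eK2] : ((1 - rho) `^ (1 / 2) <= w0 / 2 / C) &&
    ((1 - rho) `^ (1 / 2) <= a1 * (r / 32) `^ s / (2 * C)) by rewrite -le_min.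
have := @entropy_ge_annulus s w0 a1 a2 r _ (r / 32) m dist w rho s0 w00 a10 a20
    _ a2r con logw r2 rl1 intP AC _ _.
have := H m dist (1 - rho) reg e_gt0 ee0; rewrite subKr => h1 h2.
apply: le_trans (h2 _ _ _).
- by rewrite -/k -mulrA EFinM lee_wpmul2l// lee_fin ltW.
- exact: ltW.
- by rewrite mulrC -ler_pdivlMr.
- by rewrite mulrA [leLHS]mulrC -ler_pdivlMr// mulr_gt0.
Qed.

(** Take [B = w0]. Within distance [r] the gap is [O(dist^(2 s))]; farther out the kernel is at most
    [4 (1 - rho) / r^2], and the gap has total integral equal to the bracket in the conclusion. *)
Lemma entropy_upper s (w0 a1 a2 r : R) : 0 < s -> 0 < w0 -> 0 < a1 -> 0 < a2 ->
  0 < r -> a2 * r `^ s <= w0 / 2 ->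
  exists C K, [/\ 0 < C, 0 < K &
  forall m dist w rho, power_contact m dist w s w0 a1 a2 r ->
    (-oo < \int[m]_x lne (w x)%:E)%E ->
    1 / 2 <= rho -> rho < 1 ->
    (\int[m]_x (poisson_dist dist rho x)%:E = 1)%E ->
  (lne (\int[m]_x (w x * poisson_dist dist rho x)%:E) -
      \int[m]_x (lne (w x)%:E * (poisson_dist dist rho x)%:E)
   <= (C * decay_rate s rho + K * (1 - rho) *
        (ln w0 + 1 / w0 - 1 - fine (\int[m]_x lne (w x)%:E)%E))%:E)%E].
Proof.
move=> s0 w00 a10 a20 r0 a2r.
have [C [C0 CP]] := @kernel_integral_le _ T R s s0.
(* The 8 is a factor 2 from dividing by [w x >= w0 / 2] in [log_gap_le], times the 4 from
   [poisson_le_cauchy]. *)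
pose k := 8 * a2 ^+ 2 / w0 ^+ 2.
have k0 : 0 < k by rewrite divr_gt0 ?mulr_gt0 ?exprn_gt0.
exists (k * C), (4 / r ^+ 2); split.
- exact: mulr_gt0.
- by rewrite divr_gt0// exprn_gt0.
move=> m dist w rho con logw r2 r1 intP.
have [reg mw w_ge0 intw near] := con.
have [_ dist02 _ _] := reg.
have e0 : 0 < 1 - rho by rewrite subr_gt0.
have P0 x : 0 <= poisson_dist dist rho x by exact: (poisson_dist_ge0 reg).
have mP := measurable_poisson_dist reg r2 r1.
have bP : exists K, forall x, poisson_dist dist rho x <= K.
  by exists (4 / (1 - rho)) => x; exact: poisson_dist_le.
have fin := mean_fin_num mw w_ge0 intw mP P0 bP.
have Ae0 : (0 < \int[m]_x (w x * poisson_dist dist rho x)%:E)%E.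
  apply: (@lt_le_trans _ _ ((1 - rho) / 5)%:E); first by rewrite lte_fin divr_gt0.
  rewrite -[leLHS]mule1 -intw -ge0_integralZl_EFin//; last 3 first.
  - by move=> x _; rewrite lee_fin.
  - exact/measurable_EFinP.
  - by rewrite divr_ge0// ltW.
  apply: ge0_le_integral => //.
  - by move=> x _; rewrite mule_ge0// lee_fin// divr_ge0// ltW.
  - by apply: measurable_funeM; exact/measurable_EFinP.
  - by apply/measurable_EFinP; exact: measurable_funM.
  - move=> x _; rewrite -EFinM lee_fin mulrC ler_wpM2l//.
    exact: (poisson_dist_ge reg).
apply: (le_trans (entropy_integral_le mw w_ge0 intw logw mP P0 bP intP w00 Ae0)).
have e2 : 1 - rho <= 1 / 2 by lra.
have := CP m dist _ reg e0 e2; rewrite subKr => h1.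
have fl : (\int[m]_x lne (w x)%:E)%E \is a fin_num.
  by apply: integrable_fin_num => //; exact: integrable_log_density.
have h2 : (\int[m]_x log_gap w0 (w x) =
    (ln w0 + 1 / w0 - 1 - fine (\int[m]_x lne (w x)%:E)%E)%:E)%E.
  have m1 : measurable_fun setT (cst 1 : T -> R) by exact: measurable_cst.
  have p1 (x : T) : 0 <= (cst 1 : T -> R) x by [].
  have b1 : exists K : R, forall x : T, cst 1 x <= K by exists 1 => x.
  have i1 : (\int[m]_x (cst (1 : R) x)%:E = 1)%E.
    have := integral_cst m measurableT (1 : \bar R); rewrite mul1e => ->.
    exact: probability_setT.
  (* The unweighted integral of the gap is the case of the constant kernel 1. *)
  have := log_gap_integral mw w_ge0 intw logw m1 p1 b1 i1 w00.
  under eq_integral do rewrite /= mule1.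
  move=> ->; rewrite (_ : (fun x => (w x * cst 1 x)%:E) = fun x => (w x)%:E); last first.
    by apply/funext => x; rewrite mulr1.
  rewrite (_ : (fun x => lne (w x)%:E * (cst (1 : R) x)%:E)%E = fun x => lne (w x)%:E);
    last by apply/funext => x; rewrite mule1.
  by rewrite intw -[in LHS](fineK fl) -EFinB.
have mK := measurable_dist_kernel reg (2 * s) (1 - rho).
have mg := measurable_log_gap w0 mw.
(* The last summand is zero: it pads the bound to the three terms of [ge0_integral_lincomb_le]. *)
rewrite (_ : _ + _ = k * (C * decay_rate s rho) + 4 * (1 - rho) / r ^+ 2 *
    (ln w0 + 1 / w0 - 1 - fine (\int[m]_x lne (w x)%:E)%E) + 0 * 1); last first.
  by field; rewrite !gt_eqF.
set F := 4 * (1 - rho) / r ^+ 2; have F0 : 0 <= F.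
  by rewrite divr_ge0 ?sqr_ge0// mulr_ge0// ltW.
apply: (ge0_integral_lincomb_le
  (g1 := fun x => (dist x `^ (2 * s) * cauchy_kernel dist (1 - rho) x)%:E)
  (g2 := fun x => log_gap w0 (w x)) (g3 := fun x => (w x)%:E)) => //;
  rewrite ?h2 ?intw//.
- exact: ltW.
- by apply: emeasurable_funM => //; exact/measurable_EFinP.
- exact/measurable_EFinP.
- exact/measurable_EFinP.
- by move=> x; rewrite mule_ge0 ?log_gap_ge0 ?lee_fin.
- by move=> x; rewrite lee_fin mulr_ge0 ?powR_ge0// cauchy_kernel_ge0// ltW.
- by move=> x; exact: log_gap_ge0.
move=> x; rewrite mul0e adde0.
have [dx|dx] := ltP (dist x) r; last first.
  apply: (@le_trans _ _ (F%:E * log_gap w0 (w x))%E).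
    rewrite muleC lee_wpmul2r ?log_gap_ge0// lee_fin.
    exact: (poisson_dist_far reg).
  apply: leeDr; apply: mule_ge0; rewrite lee_fin; first exact: ltW.
  by rewrite mulr_ge0 ?powR_ge0// cauchy_kernel_ge0// ltW.
apply: (@le_trans _ _ (k%:E * (dist x `^ (2 * s) * cauchy_kernel dist (1 - rho) x)%:E)%E); last first.
  by rewrite leeDl// mule_ge0 ?log_gap_ge0.
have [w1 w2] := power_contact_near s0 a20 a2r con dx.
have wx0 : 0 < w x by apply: lt_le_trans w1; rewrite divr_gt0.
have [_ n2] := near x dx.
have wA2 : (w x - w0) ^+ 2 <= a2 ^+ 2 * dist x `^ (2 * s).
  rewrite -(real_normK (num_real (w x - w0))) -powR_sqr -exprMn.
  by rewrite lerXn2r ?nnegrE// mulr_ge0 ?powR_ge0// ltW.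
apply: (@le_trans _ _ ((2 * a2 ^+ 2 / w0 ^+ 2 * dist x `^ (2 * s))%:E *
    (4 * cauchy_kernel dist (1 - rho) x)%:E)%E); last first.
  by rewrite -!EFinM lee_fin le_eqVlt; apply/orP; left; apply/eqP; rewrite /k; ring.
apply: lee_pmul; rewrite ?log_gap_ge0 ?lee_fin ?poisson_le_cauchy//.
apply: (le_trans (log_gap_le w00 wx0)); rewrite lee_fin ler_pdivrMr ?mulr_gt0//.
apply: (le_trans wA2).
have -> : a2 ^+ 2 * dist x `^ (2 * s) =
    2 * a2 ^+ 2 / w0 ^+ 2 * dist x `^ (2 * s) * (w0 / 2 * w0) by field; rewrite gt_eqF.
apply: ler_wpM2l; last by rewrite ler_pM2r.
by rewrite mulr_ge0 ?powR_ge0// divr_ge0 ?sqr_ge0// mulr_ge0 ?sqr_ge0.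
Qed.

End entropy_estimates.

(** * Application to the circle *)

Section circle_entropy.
Context (R : realType).

Lemma circle_ball_regular (zeta : circle R) :
  ball_regular (circle_dist zeta) (circle_measure R).
Proof.
split.
- exact: measurable_circle_dist.
- by move=> xi; rewrite circle_dist_ge0 circle_dist_le2.
- by move=> t; exact: circle_ball_le.
- by move=> t; exact: circle_ball_ge.
Qed.

Lemma diam_centered_arc_le (zeta : circle R) (r : R) :
  0 < diam (centered_arc zeta r) -> diam (centered_arc zeta r) <= 2 * r.
Proof.
rewrite /diam; set D := (X in sup X) => D0.
(* [sup] of the empty set is 0, so a positive diameter ensures that there are distances to bound. *)
have : D !=set0.
  by apply/set0P; apply/negP => /eqP D00; move: D0; rewrite D00 sup0 ltxx.
move=> Dne; apply: sup_le_ub => // _ [xi xir [eta etar <-]].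
rewrite (_ : _ - _ = (circle_val xi - circle_val zeta) + (circle_val zeta - circle_val eta)).
  apply: (le_trans (le_normcD _ _)); rewrite -(normcN (_ - circle_val eta)) opprB.
  by move: xir etar; rewrite /centered_arc/= => ? ?; lra.
by rewrite addrA subrK.
Qed.

(** For [s <= 1/2] the rate exceeds [1 - rho] by a factor tending to infinity, either
    [|ln (1 - rho)|] or [(1 - rho)^(2 s - 1)]. It lets the far contribution be absorbed with a
    constant free of [w]. *)
Lemma linear_le_decay (s K : R) : s <= 1 / 2 -> 0 <= K -> exists e0, 0 < e0 /\
  forall rho, 1 - rho < e0 -> rho < 1 -> K * (1 - rho) <= decay_rate s rho.
Proof.
move=> s2 K0; have [sE|sN] := eqVneq s (1 / 2).
  exists (Num.min 1 (expR (- K))); split; first by rewrite lt_min ltr01 expR_gt0.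
  move=> rho; rewrite lt_min => /andP[e1 eK] r1.
  have e0 : 0 < 1 - rho by rewrite subr_gt0.
  rewrite /decay_rate sE ltxx eqxx mulrC ler_pM2l//.
  have : ln (1 - rho) < - K by rewrite -(expRK (- K)) ltr_ln ?posrE ?expR_gt0.
  by move=> h; rewrite ltr0_norm; lra.
have {sN}{}s2 : s < 1 / 2 by rewrite lt_neqAle sN.
have t0 : 0 < 1 - 2 * s by lra.
exists ((K + 1)^-1 `^ (1 / (1 - 2 * s))); split.
  by rewrite powR_gt0// invr_gt0; lra.
move=> rho eK r1; have e0 : 0 < 1 - rho by rewrite subr_gt0.
rewrite /decay_rate ltNge (ltW s2) (lt_eqF s2)/=.
have h : (1 - rho) `^ (1 - 2 * s) <= (K + 1)^-1.
  by apply: powR_le_root => //; rewrite ?(ltW e0) ?(ltW eK)// invr_ge0; lra.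
have eE : 1 - rho = (1 - rho) `^ (1 - 2 * s) * (1 - rho) `^ (2 * s).
  by rewrite -powRD ?(gt_eqF e0) ?implybT// subrK powRr1// ltW.
rewrite {1}eE mulrA ler_piMl ?powR_ge0//.
apply: (@le_trans _ _ (K * (K + 1)^-1)); first exact: ler_wpM2l.
by rewrite ler_pdivrMr ?mul1r ?lerDl//; lra.
Qed.

End circle_entropy.

Theorem theorem2 (R : realType) (s delta w0 a1 a2 : R)
    (s_gt0 : 0 < s) (delta_gt0 : 0 < delta) (w0_gt0 : 0 < w0)
    (a1_gt0 : 0 < a1) (a2_gt0 : 0 < a2) :
  exists (c1 : R) (c2 : R -> R),
    [/\ 0 < c1,
        forall h, 0 < c2 h,
        s <= 1 / 2 -> forall h h', c2 h = c2 h' &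
        forall (mu : probability (circle R) R) (w : circle R -> R)
               (zeta : circle R) (I : set (circle R)) (r : R),
          szego mu ->
          lebesgue_decomposition mu w mzero ->
          centered_arc zeta r `<=` I ->
          diam (centered_arc zeta r) = delta ->
          (forall xi, I xi -> 0 < w xi) ->
          {within I, continuous w} ->
          w zeta = w0 ->
          (forall xi, I xi ->
             a1 * normc (circle_val xi - circle_val zeta) `^ s <= `|w xi - w zeta|
             /\ `|w xi - w zeta| <= a2 * normc (circle_val xi - circle_val zeta) `^ s) ->
          \forall rho \near 1^'-,
            ((c1 * decay_rate s rho)%:E
               <= entropy mu w (real_complex R rho * circle_val zeta)%R)%E
            /\ (entropy mu w (real_complex R rho * circle_val zeta)%R
               <= (c2 (fine (log_integral w)) * decay_rate s rho)%:E)%E].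
Proof.
(* A radius depending only on the given constants: [delta / 2] is at most [r] by
   [diam_centered_arc_le], and the last term keeps [w] between [w0 / 2] and [3 w0 / 2]. *)
pose r1 : R := Num.min (delta / 2) (Num.min 1 ((w0 / 2 / a2) `^ (1 / s))).
have r1_gt0 : 0 < r1 by rewrite !lt_min !divr_gt0//= ltr01 powR_gt0// !divr_gt0.
have r1_le1 : r1 <= 1 by rewrite /r1 !ge_min lexx orbT.
have a2r : a2 * r1 `^ s <= w0 / 2.
  rewrite mulrC -ler_pdivlMr//; apply: powR_le_root => //.
  - by rewrite !divr_ge0// ltW.
  - exact: ltW.
  - by rewrite /r1 !ge_min lexx !orbT.
have [c1 [e1 [c10 e10 lower]]] := @entropy_lower _ (circle R) R s w0 a1 a2 r1
  s_gt0 w0_gt0 a1_gt0 a2_gt0 r1_gt0 r1_le1 a2r.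
have [C [K [C0 K0 upper]]] := @entropy_upper _ (circle R) R s w0 a1 a2 r1
  s_gt0 w0_gt0 a1_gt0 a2_gt0 r1_gt0 a2r.
(* The absolute value bounds the bracket of [entropy_upper] and keeps [c2 h] positive for every real
   [h]. *)
pose H h : R := `|ln w0 + 1 / w0 - 1 - h|.
exists c1, (fun h => if s <= 1 / 2 then C + 1 else C + K * H h); split => //.
- by move=> h; case: ifP => _; rewrite ltr_pwDl// mulr_ge0 ?normr_ge0// ltW.
- by move=> s2 h h'; rewrite s2.
move=> mu w zeta I r sz dec arcI dia _ _ wz near.
have [mw w_ge0 _ muE] := dec.
have muw A : measurable A -> mu A = (\int[circle_measure R]_(xi in A) (w xi)%:E)%E.
  by move=> mA; rewrite muE// /mzero adde0.
have intw : (\int[circle_measure R]_xi (w xi)%:E = 1)%E.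
  by rewrite -muw// probability_setT.
have logw : (-oo < \int[circle_measure R]_xi lne (w xi)%:E)%E by exact: (sz w mzero dec).
have reg := circle_ball_regular zeta.
have rr : r1 <= r.
  have := @diam_centered_arc_le R zeta r; rewrite dia => /(_ delta_gt0) dr.
  by rewrite /r1 ge_min; apply/orP; left; lra.
have con : power_contact (circle_measure R) (circle_dist zeta) w s w0 a1 a2 r1.
  split => // xi xr; rewrite -wz; apply: near; apply: arcI.
  exact: lt_le_trans xr rr.
pose h := fine (log_integral w).
(* The threshold [e2] may depend on [mu]: for [s <= 1/2] the integral of [log w] then only affects
   how close [rho] must be to 1, not [c2]. *)
have [e2 [e20 lin]] : exists e2 : R, 0 < e2 /\ (s <= 1 / 2 -> forall rho, 1 - rho < e2 ->
    rho < 1 -> K * H h * (1 - rho) <= decay_rate s rho).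
  have [s2|s2] := leP s (1 / 2); last by exists 1; split.
  have [e2 [e20 E]] := linear_le_decay s2 (mulr_ge0 (ltW K0) (normr_ge0 _ : 0 <= H h)).
  by exists e2.
near=> rho.
have rho1 : rho < 1 by near: rho; exact: nbhs_left_lt.
have rho2 : 1 / 2 <= rho by near: rho; apply: nbhs_left_ge; lra.
have rhoe1 : 1 - rho < e1.
  by rewrite ltrBlDl -ltrBlDr; near: rho; apply: nbhs_left_gt; rewrite gtrBl.
have rhoe2 : 1 - rho < e2.
  by rewrite ltrBlDl -ltrBlDr; near: rho; apply: nbhs_left_gt; rewrite gtrBl.
have rho0 : 0 <= rho by exact: le_trans rho2.
have PE : poisson_kernel (real_complex R rho * circle_val zeta) =
    poisson_dist (circle_dist zeta) rho.
  by apply/funext => xi; rewrite poisson_kernelE.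
have intP := poisson_kernel_integral zeta rho0 rho1.
have mP := measurable_poisson_kernel zeta rho0.
rewrite PE in intP mP; rewrite /entropy PE.
rewrite (integral_density mw muw mP) => [|xi]; last exact: (poisson_dist_ge0 reg).
split; first exact: lower.
apply: (le_trans (upper _ _ _ _ con logw rho2 rho1 intP)); rewrite lee_fin -/(log_integral w) -/h.
have Hh : K * (1 - rho) * (ln w0 + 1 / w0 - 1 - h) <= K * H h * (1 - rho).
  by rewrite mulrAC ler_wpM2r ?subr_ge0 ?(ltW rho1)// ler_wpM2l ?(ltW K0)// ler_norm.
case: ifPn => s2.
  by rewrite mulrDl (mul1r (decay_rate _ _)) lerD2l (le_trans Hh)// lin.
(* Here [s > 1/2], so the rate is [1 - rho] itself, and the far contribution is the second part of
   [c2 h] times it. *)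
rewrite mulrDl lerD2l (le_trans Hh)// /decay_rate ltNge s2//.
Unshelve. all: by end_near. Qed.
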